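(* Let $F=\beta e^{\pm\alpha^2/\beta^2}$ (with either fixed choice of sign) be a metric on an $n$-dimensional manifold $M$ such that either $F$ is a Landsberg metric and $n\ge 3$, or $F$ is a Douglas metric. Then any conformal vector field of $F$ is homothetic.
   Context: Manifolds are assumed connected. Here $\alpha=\sqrt{a_{ij}(x)y^iy^j}$ is a positive definite Riemannian metric and $\beta=b_i(x)y^i$ is a nowhere vanishing 1-form on $M$; $F$ is a singular Finsler metric, considered on the open conic part of $TM\setminus 0$ where it is defined and positive (e.g. $\beta>0$). Conformal and homothetic vector fields: for $V=V^i\partial/\partial x^i$ let $V^c:=V^i\frac{\partial}{\partial x^i}+y^i\frac{\partial V^j}{\partial x^i}\frac{\partial}{\partial y^j}$ be its complete lift to $TM$ (the superscript $c$ is only notation). $V$ is a conformal vector field of $F$ with conformal factor $c=c(x)$ if $V^c(F)=2cF$ (equivalently, the lifted flow $\widetilde\varphi_t$ of $V$ satisfies $\widetilde\varphi_t^*F=e^{2\sigma_t}F$ with $\sigma_t$ functions on $M$, $c=\frac{d}{dt}|_{t=0}\sigma_t$). $V$ is homothetic if it is conformal with constant conformal factor $c$. Let $g_{ij}=\frac12[F^2]_{y^iy^j}$ and let $G^i=\frac14 g^{il}\{[F^2]_{x^ky^l}y^k-[F^2]_{x^l}\}$ be the spray coefficients of $F$. $F$ is a Landsberg metric if its Landsberg curvature $L_{jkl}=-\frac12 F F_{y^i}[G^i]_{y^jy^ky^l}$ vanishes. $F$ is a Douglas metric if $G^iy^j-G^jy^i$ are homogeneous polynomials of degree three in $y$;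 equivalently, locally $G^i=\frac12\Gamma^i_{jk}(x)y^jy^k+P(x,y)y^i$.
   Formalization: The formal theorem assumes n ≥ 2: for n = 1 the Douglas case is false (on M = R with α² = y², β = y, F = e^{±1}y is trivially Douglas, and V = x² d/dx is conformal with the non-constant factor x). *)

(* Defs.v *)
From mathcomp Require Import all_boot all_order all_algebra.
From mathcomp Require Import all_classical all_reals all_analysis.
Set Implicit Arguments.
Unset Strict Implicit.
Unset Printing Implicit Defensive.
Import Order.TTheory GRing.Theory Num.Theory.
Import numFieldNormedType.Exports.
Local Open Scope classical_set_scope.
Local Open Scope ring_scope.

(* Points and tangent vectors of R^n are row vectors. *)

Section Calculus.
Variables (R : realType) (n : nat).
Local Notation E := 'rV[R]_n.

Definition partial (k : 'I_n) (f : E -> R) (x : E) : R :=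
  'D_(delta_mx 0 k) f x.

(* C^k on U (meant for open U), by recursion on the order *)
Fixpoint Ck (k : nat) (U : set E) (f : E -> R) : Prop :=
  (forall x, U x -> {for x, continuous f}) /\
  if k is k'.+1 then
    forall i : 'I_n, (forall x, U x -> derivable f x (delta_mx 0 i)) /\
                     Ck k' U (partial i f)
  else True.

Definition smooth_on (U : set E) (f : E -> R) : Prop := forall k, Ck k U f.

Definition dx (k : 'I_n) (f : E -> E -> R) : E -> E -> R :=
  fun x y => partial k (fun z => f z y) x.
Definition dy (k : 'I_n) (f : E -> E -> R) : E -> E -> R :=
  fun x y => partial k (f x) y.

End Calculus.

Section Manifold.
Variables (R : realType) (n : nat).
Local Notation E := 'rV[R]_n.

Record chart (T : topologicalType) := Chart {
  cdom : set T;
  ccod : set E;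
  to_coord : T -> E;
  of_coord : E -> T;
  cdom_open : open cdom;
  ccod_open : open ccod;
  to_coord_in : forall p, cdom p -> ccod (to_coord p);
  of_coord_in : forall x, ccod x -> cdom (of_coord x);
  to_coordK : forall p, cdom p -> of_coord (to_coord p) = p;
  of_coordK : forall x, ccod x -> to_coord (of_coord x) = x;
  to_coord_continuous : forall p, cdom p -> {for p, continuous to_coord};
  of_coord_continuous : forall x, ccod x -> {for x, continuous of_coord}
}.

Definition overlap (T : topologicalType) (c d : chart T) : set E :=
  [set x | ccod c x /\ cdom d (of_coord c x)].

Definition transition (T : topologicalType) (c d : chart T) (x : E) : E :=
  to_coord d (of_coord c x).

(* entry (k, l) is the derivative of the l-th d-coordinate with respect to the
   k-th c-coordinate; it acts on row vectors from the right *)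
Definition transition_jac (T : topologicalType) (c d : chart T) (x : E) :
    'M[R]_n :=
  \matrix_(k, l) partial k (fun z => transition c d z 0 l) x.

Record manifold := Manifold {
  mcarrier :> topologicalType;
  mhausdorff : hausdorff_space mcarrier;
  msecond_countable : @second_countable mcarrier;
  mconnected : connected [set: mcarrier];
  mindex : Type;
  mchart : mindex -> chart mcarrier;
  mcover : forall p : mcarrier, exists i, cdom (mchart i) p;
  mcompatible : forall i j (l : 'I_n),
    smooth_on (overlap (mchart i) (mchart j))
      (fun x => transition (mchart i) (mchart j) x 0 l)
}.

Variable M : manifold.
Local Notation ch := (@mchart M).

(* Tensor fields are families of smooth components, one for each chart of the
   atlas, related by the tensorial transformation law on overlaps. *)

Record vector_field := VectorField {
  vcoord : mindex M -> E -> E;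
  vsmooth : forall i (k : 'I_n),
    smooth_on (ccod (ch i)) (fun x => vcoord i x 0 k);
  vtransform : forall i j x, overlap (ch i) (ch j) x ->
    vcoord j (transition (ch i) (ch j) x) =
    vcoord i x *m transition_jac (ch i) (ch j) x
}.

Record one_form := OneForm {
  bcoord : mindex M -> E -> E;
  bsmooth : forall i (k : 'I_n),
    smooth_on (ccod (ch i)) (fun x => bcoord i x 0 k);
  btransform : forall i j x, overlap (ch i) (ch j) x ->
    bcoord i x = bcoord j (transition (ch i) (ch j) x)
                 *m (transition_jac (ch i) (ch j) x)^T
}.

Definition nowhere_vanishing (b : one_form) : Prop :=
  forall i x, ccod (ch i) x -> bcoord b i x != 0.

Record riemannian_metric := RiemannianMetric {
  acoord : mindex M -> E -> 'M[R]_n;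
  asmooth : forall i (k l : 'I_n),
    smooth_on (ccod (ch i)) (fun x => acoord i x k l);
  atransform : forall i j x, overlap (ch i) (ch j) x ->
    acoord i x = transition_jac (ch i) (ch j) x
                 *m acoord j (transition (ch i) (ch j) x)
                 *m (transition_jac (ch i) (ch j) x)^T;
  asymmetric : forall i x, ccod (ch i) x -> (acoord i x)^T = acoord i x;
  apositive : forall i x (y : E), ccod (ch i) x -> y != 0 ->
    0 < \sum_(k < n) \sum_(l < n) acoord i x k l * y 0 k * y 0 l
}.

Definition alpha (a : riemannian_metric) (i : mindex M) (x y : E) : R :=
  Num.sqrt (\sum_(k < n) \sum_(l < n) acoord a i x k l * y 0 k * y 0 l).

Definition beta (b : one_form) (i : mindex M) (x y : E) : R :=
  \sum_(k < n) bcoord b i x 0 k * y 0 k.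

(* A function on (part of) TM, read in the induced coordinates (x, y) of each
   chart. *)
Definition tangent_function := mindex M -> E -> E -> R.

(* beta e^{alpha^2/beta^2} if s = false, beta e^{-alpha^2/beta^2} if s = true.
   Where beta = 0 the total division makes this 0, so it is positive exactly
   where beta > 0. *)
Definition exp_metric (a : riemannian_metric) (b : one_form) (s : bool) :
    tangent_function :=
  fun i x y =>
    beta b i x y * expR ((-1) ^+ s * (alpha a i x y ^+ 2 / beta b i x y ^+ 2)).

End Manifold.

Section Local_curvatures.
Variables (R : realType) (n : nat).
Local Notation E := 'rV[R]_n.
Variable F : E -> E -> R.

Definition Fsq (x y : E) : R := F x y ^+ 2.

Definition fundamental_tensor (x y : E) : 'M[R]_n :=
  \matrix_(i, j) (2^-1 * dy j (dy i Fsq) x y).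

Definition spray_coef (i : 'I_n) (x y : E) : R :=
  4^-1 * \sum_(l < n) invmx (fundamental_tensor x y) i l *
    (\sum_(k < n) dy l (dx k Fsq) x y * y 0 k - dx l Fsq x y).

Definition landsberg_curvature (j k l : 'I_n) (x y : E) : R :=
  - 2^-1 * F x y *
  \sum_(i < n) dy i F x y * dy l (dy k (dy j (spray_coef i))) x y.

Definition complete_lift (V : E -> E) (x y : E) : R :=
  \sum_(i < n) V x 0 i * dx i F x y +
  \sum_(i < n) \sum_(j < n)
     y 0 i * partial i (fun z => V z 0 j) x * dy j F x y.

End Local_curvatures.

Section Metrics.
Variables (R : realType) (n : nat) (M : manifold R n).
Local Notation E := 'rV[R]_n.
Local Notation ch := (@mchart R n M).
Variable F : tangent_function M.

Definition in_domain (i : mindex M) (x y : E) : Prop :=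
  ccod (ch i) x /\ 0 < F i x y.

(* The spray, hence both curvature conditions, is defined only where g_ij is
   invertible; for beta e^{-alpha^2/beta^2} this fails on a hypersurface of
   each cone beta > 0. *)
Definition in_regular_domain (i : mindex M) (x y : E) : Prop :=
  in_domain i x y /\ fundamental_tensor (F i) x y \in unitmx.

Definition landsberg : Prop :=
  forall i x y, in_regular_domain i x y ->
  forall j k l : 'I_n, landsberg_curvature (F i) j k l x y = 0.

Definition homogeneous_cubic (q : E -> R) : Prop :=
  exists c : 'I_n -> 'I_n -> 'I_n -> R, forall y,
    q y = \sum_(k < n) \sum_(l < n) \sum_(m < n)
            c k l m * y 0 k * y 0 l * y 0 m.

Definition douglas : Prop :=
  forall i x, ccod (ch i) x -> forall j k : 'I_n,
  exists2 q, homogeneous_cubic q &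
    forall y, in_regular_domain i x y ->
      spray_coef (F i) j x y * y 0 k - spray_coef (F i) k x y * y 0 j = q y.

Definition conformal_with_factor (V : vector_field M) (c : M -> R) : Prop :=
  forall i x y, in_domain i x y ->
    complete_lift (F i) (vcoord V i) x y = 2 * c (of_coord (ch i) x) * F i x y.

Definition conformal (V : vector_field M) : Prop :=
  exists c : M -> R, conformal_with_factor V c.

Definition homothetic (V : vector_field M) : Prop :=
  exists c : R, conformal_with_factor V (fun _ => c).

End Metrics.

(* Main.v *)
Require Import Defs.
From mathcomp Require Import all_boot all_order all_algebra.
From mathcomp Require Import all_classical all_reals all_analysis.
From mathcomp Require Import ring lra.
Set Implicit Arguments.
Unset Strict Implicit.
Unset Printing Implicit Defensive.
Import Order.TTheory GRing.Theory Num.Theory.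
Import numFieldNormedType.Exports.
Local Open Scope classical_set_scope.
Local Open Scope ring_scope.

(** Write $A = \alpha^2$ and $\epsilon = \pm 1$, so that
    $F = \beta e^{\epsilon A/\beta^2}$.

    The pair $(\alpha, \beta)$ is not determined by $F$: adding $k\beta^2$ to $A$
    multiplies $F$ by $e^{\epsilon k}$, and multiplying $\alpha$ and $\beta$ by
    $e^{-\epsilon k}$ undoes this.  With $k = 1 - |\beta|^{-2}$ the new form has
    length $1$ for the new metric, so that $F$ is given by a unit form
    ([exp_norm_normalized]).  Let $X$ be the vector field dual to it.

    A Landsberg or Douglas metric has $X$ Killing.  On the plane spanned by $X$ and
    some $z$ orthogonal to it, the Euler-Lagrange equations of $F^2$ paired with
    $X$ and $z$ form a linear system for the two components of the spray
    ([plane_solution]).  At $X + tz$ its solution is a polynomial in $t$ plus terms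
    $N(t)/D(t)$ and $t N(t)/D(t)$, where
    $D(t) = 1 + 2\epsilon t^2|z|^2$ and
    $N(t) = t^2\rho + (2t^2|z|^2 - \epsilon)t\sigma$ with $\rho = (\nabla\beta)(z,z)$
    and $\sigma = \frac12 d\beta(z,X)$.  The Douglas condition makes $tN/D$ a cubic,
    which forces $\rho = \sigma = 0$ ([douglas_relation]).  The Landsberg condition
    says that a fixed combination of the two components has vanishing third
    derivative at $t = 1$, that is $\rho + (2|z|^2 - \epsilon)\sigma = 0$
    ([landsberg_relation]); replacing $z$ by $-z$ again gives $\rho = \sigma = 0$
    for short $z$.  Together with $|\beta| = 1$ this is the Killing equation
    $(\nabla\beta)(v,v) = 0$.

    A conformal field $V$ of $F$ satisfies $L_V\beta = 2c\beta$ and $L_VA = 4cA$ for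
    the normalized pair ([lie_equations]); the unit length excludes a multiple of
    $\beta^2$ in $L_VA$.  Hence $[X,V] = 2cX$, and commuting $L_V$ past $L_XA = 0$
    leaves $dc\cdot\beta = (Xc)A$ as quadratic forms
    ([conformal_factor_relation]).  The left side vanishes on the kernel of $\beta$
    and $A$ is definite, so in dimension at least two $Xc = 0$, and then $dc = 0$
    ([gradient_eq0]).  As $M$ is connected, $c$ is constant. *)

(** * Directional derivatives *)

Section Directional.
Variables (R : realType) (E : normedModType R).
Implicit Types (f g : E -> R) (U : set E) (x v w : E).

Lemma is_derive_line f x v t : derivable f (t *: v + x) v ->
  is_derive t (1 : R) (fun s => f (s *: v + x)) ('D_v f (t *: v + x)).
Proof.
move=> df.
have E1 : (fun h : R => h^-1 *: (f ((h *: (1:R) + t) *: v + x) - f (t *: v + x)))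
   = (fun h => h^-1 *: (f (h *: v + (t *: v + x)) - f (t *: v + x))).
  apply/funext => h; congr (_ *: (f _ - _)).
  by rewrite scalerDl -scalerA scale1r addrA.
by apply: DeriveDef; rewrite /derivable /derive /= E1.
Qed.

Lemma MVT_line f x v : (forall t : R, 0 <= t <= 1 -> derivable f (t *: v + x) v) ->
  exists2 t : R, 0 <= t <= 1 & f (v + x) - f x = 'D_v f (t *: v + x).
Proof.
move=> df.
have [||t] := @MVT_segment R (fun s => f (s *: v + x)) (fun t => 'D_v f (t *: v + x)) 0 1 ler01.
- move=> t; rewrite in_itv /= => /andP[t0 t1]; apply: is_derive_line.
  by apply: df; rewrite !ltW.
- apply: continuous_in_subspaceT => t; rewrite inE /= in_itv /= => tI.
  by have := is_derive_line (df t tI) => -[] /derivable1_diffP /differentiable_continuous.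
rewrite in_itv /= => tI; rewrite scale1r scale0r add0r subr0 mulr1 => ->.
by exists t.
Qed.

Lemma is_derive_scale f x v (k d : R) : is_derive x v f d ->
  is_derive x (k *: v) f (k * d).
Proof.
move=> [df dv].
have H0 : is_derive (0 : R) 1 (fun s => f (s *: v + x)) d.
  by rewrite -dv -{2}[x]add0r -(scale0r v); apply: is_derive_line; rewrite scale0r add0r.
have H1 : is_derive (0 : R) 1 (fun s : R => f (s *: (k *: v) + x)) (k * d).
  have Hk : is_derive (0 : R) 1 (fun s : R => s * k) k.
    apply: is_derive_eq (is_deriveM (is_derive_id _ _) (is_derive_cst k _ _)) _.
    by rewrite /= scaler0 add0r [_ *: _]mulr1.
  have := @is_derive1_comp R (fun s => f (s *: v + x)) (fun s => s * k) 0 d k.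
  rewrite mul0r mulrC => /(_ H0 Hk).
  by congr (is_derive _ _ _ _); apply/funext => s /=; rewrite scalerA.
have -> : k * d = 'D_(k *: v) f x.
  rewrite -(@derive_val _ _ _ _ _ _ _ H1) /derive; congr (lim _).
  suff -> : (fun h : R => h^-1 *: (((fun s : R => f (s *: (k *: v) + x)) \o shift 0) (h *: 1) - f (0 *: (k *: v) + x))) =
            (fun h : R => h^-1 *: ((f \o shift x) (h *: (k *: v)) - f x)) by [].
  apply/funext => h /=; rewrite scale0r add0r addr0.
  by rewrite [h *: 1]mulr1.
apply: derivableP; apply/derivable1P.
by case: H1.
Qed.

(** The two increments of [f] along [v] and then along [w] are compared through
    the mean value theorem on the second one. *)
Lemma is_deriveD_dir f U x v w : open U -> U x ->
  (forall z, U z -> derivable f z w) -> {for x, continuous ('D_w f)} ->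
  derivable f x v -> is_derive x (v + w) f ('D_v f x + 'D_w f x).
Proof.
move=> oU Ux dw cw dv.
suff cv : (fun h : R => h^-1 *: ((f \o shift x) (h *: (v + w)) - f x)) @ 0^' -->
   'D_v f x + 'D_w f x.
  by apply: DeriveDef; [apply/cvg_ex; eexists; exact: cv | exact: cvg_lim cv].
have E1 : (fun h : R => h^-1 *: ((f \o shift x) (h *: (v + w)) - f x)) =
  (fun h : R => h^-1 *: ((f \o shift x) (h *: v) - f x)) \+
  (fun h : R => h^-1 *: (f (h *: w + (h *: v + x)) - f (h *: v + x))).
  apply/funext => h /=; rewrite -scalerDr; congr (_ *: _).
  rewrite scalerDr [h *: v + h *: w]addrC -addrA.
  by ring.
rewrite E1; apply: cvgD; first exact: dv.
apply/cvgrPdist_lt => e e0.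
have nU : nbhs x (U `&` [set z | `|'D_w f x - 'D_w f z| < e]).
  apply: filterI; first exact: open_nbhs_nbhs.
  by move/cvgrPdist_lt: cw; exact.
have [r /= r0 rU] := (nbhs_ballP _ _).1 nU.
near=> h.
have h0 : h != 0 by near: h; exact: nbhs_dnbhs_neq.
have hb t : 0 <= t <= 1 -> ball x r (t *: (h *: w) + (h *: v + x)).
  move=> /andP[t0 t1]; rewrite -ball_normE /= addrA opprD addrCA subrr addr0 normrN.
  rewrite (le_lt_trans (ler_normD _ _))// !normrZ (ger0_norm t0).
  rewrite (le_lt_trans (y := `|h| * (`|w| + `|v|)))//.
    by rewrite mulrDr lerD2r ler_piMl// mulr_ge0.
  have wv1 : 0 < `|w| + `|v| + 1 by rewrite ltr_wpDl// addr_ge0.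
  rewrite (le_lt_trans (y := `|h| * (`|w| + `|v| + 1)))//.
    by rewrite ler_wpM2l// lerDl.
  rewrite -ltr_pdivlMr//; near: h; apply: dnbhs0_lt; exact: divr_gt0.
have [|t tI] := @MVT_line f (h *: v + x) (h *: w).
  move=> t tI; have [U1 _] := rU _ (hb t tI).
  by case: (is_derive_scale h (derivableP (dw _ U1))).
have [U1 /=] := rU _ (hb t tI).
case: (is_derive_scale h (derivableP (dw _ U1))) => _ -> + ->.
by rewrite [_ *: (_ * _)]mulKf.
Unshelve. all: by end_near. Qed.

(** Two applications of the mean value theorem.  The second difference is
    symmetric in [v] and [w], hence so is the mixed derivative that it
    approximates. *)
Lemma second_difference f U x v w (e : R) : open U -> U x ->
  (forall z, U z -> derivable f z v) ->
  (forall z, U z -> derivable ('D_v f) z w) ->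
  {for x, continuous ('D_w ('D_v f))} -> 0 < e ->
  \forall h \near (0 : R), `|f (h *: v + (h *: w + x)) - f (h *: w + x)
     - f (h *: v + x) + f x - h ^+ 2 * 'D_w ('D_v f) x| <= e * h ^+ 2.
Proof.
move=> oU Ux dv dvw cvw e0.
have nU : nbhs x (U `&` [set z | `|'D_w ('D_v f) x - 'D_w ('D_v f) z| < e]).
  apply: filterI; first exact: open_nbhs_nbhs.
  by move/cvgrPdist_lt: cvw; exact.
have [r /= r0 rU] := (nbhs_ballP _ _).1 nU.
near=> h.
have hb t s : 0 <= t <= 1 -> 0 <= s <= 1 ->
    ball x r (s *: (h *: w) + (t *: (h *: v) + x)).
  move=> /andP[t0 t1] /andP[s0 s1].
  rewrite -ball_normE /= addrA opprD addrCA subrr addr0 normrN.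
  rewrite (le_lt_trans (ler_normD _ _))// !normrZ (ger0_norm t0) (ger0_norm s0).
  rewrite (le_lt_trans (y := `|h| * (`|w| + `|v|)))//.
    by rewrite mulrDr lerD// ler_piMl// mulr_ge0.
  have wv1 : 0 < `|w| + `|v| + 1 by rewrite ltr_wpDl// addr_ge0.
  rewrite (le_lt_trans (y := `|h| * (`|w| + `|v| + 1)))//.
    by rewrite ler_wpM2l// lerDl.
  rewrite -ltr_pdivlMr//; near: h; apply: cvgr0_norm_lt; [exact: cvg_id | exact: divr_gt0].
pose g z := f (h *: w + z) - f z.
have hb0 t : 0 <= t <= 1 -> ball x r (t *: (h *: v) + x).
  by move=> tI; have := hb t 0 tI; rewrite lexx ler01 scale0r add0r; exact.
have hb1 t : 0 <= t <= 1 -> ball x r (h *: w + (t *: (h *: v) + x)).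
  by move=> tI; have := hb t 1 tI; rewrite lexx ler01 scale1r; exact.
have dg t : 0 <= t <= 1 -> is_derive (t *: (h *: v) + x) (h *: v) g
    (h * ('D_v f (h *: w + (t *: (h *: v) + x)) - 'D_v f (t *: (h *: v) + x))).
  move=> tI; apply: is_derive_scale.
  have [U1 _] := rU _ (hb1 t tI); have [U0 _] := rU _ (hb0 t tI).
  apply: is_deriveB; last exact/derivableP/dv.
  have := derivableP (dv _ U1).
  have E1 : (fun k : R => k^-1 *: (((fun z => f (h *: w + z)) \o shift (t *: (h *: v) + x)) (k *: v) - f (h *: w + (t *: (h *: v) + x))))
    = (fun k : R => k^-1 *: ((f \o shift (h *: w + (t *: (h *: v) + x))) (k *: v) - f (h *: w + (t *: (h *: v) + x)))).
    by apply/funext => k /=; rewrite addrCA.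
  by case=> d1 d2; apply: DeriveDef; rewrite /derivable /derive E1.
have [|t tI] := @MVT_line g x (h *: v); first by move=> t /dg[].
have [_ ->] := dg t tI.
have [|s sI ->] := @MVT_line ('D_v f) (t *: (h *: v) + x) (h *: w).
  move=> s sI; have [U1 _] := rU _ (hb t s tI sI).
  by case: (is_derive_scale h (derivableP (dvw _ U1))).
have [U1 /= Ue] := rU _ (hb t s tI sI).
have [_ ->] := is_derive_scale h (derivableP (dvw _ U1)).
rewrite /g => gE.
have -> : f (h *: v + (h *: w + x)) - f (h *: w + x) - f (h *: v + x) + f x =
   (f (h *: w + (h *: v + x)) - f (h *: v + x)) - (f (h *: w + x) - f x).
  by rewrite [h *: v + _]addrCA; ring.
rewrite gE.
set d0 := 'D_w _ x in Ue *; set d1 := 'D_w _ _ in Ue *.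
have -> : h * (h * d1) - h ^+ 2 * d0 = (d1 - d0) * h ^+ 2 by ring.
rewrite normrM (ger0_norm (sqr_ge0 h)); apply: ler_wpM2r; first exact: sqr_ge0.
by rewrite distrC; exact: ltW.
Unshelve. all: by end_near. Qed.

Lemma derive_comm f U x v w : open U -> U x ->
  (forall z, U z -> derivable f z v) -> (forall z, U z -> derivable f z w) ->
  (forall z, U z -> derivable ('D_v f) z w) ->
  (forall z, U z -> derivable ('D_w f) z v) ->
  {for x, continuous ('D_w ('D_v f))} -> {for x, continuous ('D_v ('D_w f))} ->
  'D_w ('D_v f) x = 'D_v ('D_w f) x.
Proof.
move=> oU Ux dv dw dvw dwv cvw cwv.
apply/eqP; rewrite -subr_eq0 -normr_le0; apply/ler_addgt0Pr => e e0; rewrite add0r.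
have e20 : 0 < e / 2 by rewrite divr_gt0.
have nd := second_difference oU Ux dv dvw cvw e20.
have nd' := second_difference oU Ux dw dwv cwv e20.
have [h [h0 [H1 H2]]] := filter_ex (filterI (nbhs_dnbhs_neq (0 : R))
  (filterI (nbhs_dnbhs nd) (nbhs_dnbhs nd'))).
have h2 : 0 < h ^+ 2 by rewrite exprn_even_gt0.
move: H1 H2; rewrite /= [h *: w + (_ + _)]addrCA.
move: (f _) (f (_ + x)) (f (_ + x)) (f x) ('D_w _ x) ('D_v _ x) => p q' q r d1 d2.
move=> H1 H2; rewrite -(ler_pM2r h2) -[X in _ * X <= _](ger0_norm (ltW h2)) -normrM.
have -> : (d1 - d2) * h ^+ 2 = (p - q' - q + r - h ^+ 2 * d2) -
    (p - q - q' + r - h ^+ 2 * d1) by ring.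
apply: (le_trans (ler_normB _ _)).
have -> : e * h ^+ 2 = e / 2 * h ^+ 2 + e / 2 * h ^+ 2 by field.
exact: lerD.
Qed.
End Directional.

(** * Functions of class C^k on open sets *)

Section SmoothClosure.
Variables (R : realType) (n : nat).
Local Notation E := 'rV[R]_n.
Implicit Types (f g : E -> R) (U : set E) (x v : E).

Lemma is_derive_comp1 (phi : R -> R) f x v (a d : R) :
  is_derive (f x) 1 phi a -> is_derive x v f d ->
  is_derive x v (fun z => phi (f z)) (a * d).
Proof.
move=> dphi [df <-].
have H0 := @is_derive_line R E f x v 0; rewrite scale0r add0r in H0.
have H1 := @is_derive1_comp R phi (fun s => f (s *: v + x)) 0 a ('D_v f x).
rewrite scale0r add0r in H1.
have [d1 d2] := H1 dphi (H0 df).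
apply: DeriveDef; first by apply/derivable1P.
rewrite -d2 /derive; congr (lim _).
suff -> : (fun h : R => h^-1 *: (((phi \o (fun s : R => f (s *: v + x))) \o shift 0) (h *: 1) -
      (phi \o (fun s : R => f (s *: v + x))) 0)) =
  (fun h : R => h^-1 *: (((fun z => phi (f z)) \o shift x) (h *: v) - phi (f x))) by [].
by apply/funext => h /=; rewrite scale0r add0r addr0 [h *: 1]mulr1.
Qed.

Lemma Ck_cont k U f x : Ck k U f -> U x -> {for x, continuous f}.
Proof. by case: k => [|k] [] + _ Ux => /(_ x Ux). Qed.

Lemma CkS k U f : Ck k.+1 U f -> Ck k U f.
Proof.
elim: k f => [|k IH] f; first by case.
case=> cf df; split=> // i; have [df1 df2] := df i; split=> //; exact: IH.
Qed.

Lemma Ck_partial k U f i : Ck k.+1 U f -> Ck k U (partial i f).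
Proof. by case=> _ /(_ i)[]. Qed.

Lemma Ck_derivable k U f i x : Ck k.+1 U f -> U x -> derivable f x (delta_mx 0 i).
Proof. by case=> _ /(_ i)[+ _] Ux; apply. Qed.

Lemma Ck_is_derive k U f i x : Ck k.+1 U f -> U x ->
  is_derive x (delta_mx 0 i) f (partial i f x).
Proof. move=> Cf Ux; apply: derivableP; exact: Ck_derivable Cf Ux. Qed.

Arguments Ck_partial [k U f] i _.

Lemma Ck_subset k U V f : V `<=` U -> Ck k U f -> Ck k V f.
Proof.
move=> VU; elim: k f => [|k IH] f [cf df]; split=> //.
- by move=> x /VU; exact: cf.
- by move=> x /VU; exact: cf.
move=> i; have [df1 df2] := df i; split; last exact: IH.
by move=> x /VU; exact: df1.
Qed.

Lemma open_near_eq U f g x : open U -> U x -> (forall z, U z -> f z = g z) ->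
  \near x, f x = g x.
Proof.
move=> oU Ux fg; near=> z; apply: fg; near: z; exact: open_nbhs_nbhs.
Unshelve. all: by end_near. Qed.

Lemma is_derive_open U f g x v (d : R) : open U -> U x ->
  (forall z, U z -> f z = g z) -> is_derive x v f d -> is_derive x v g d.
Proof. by move=> oU Ux fg; apply: near_eq_is_derive; exact: open_near_eq oU Ux fg. Qed.

Lemma continuous_open_eq U f g x : open U -> U x ->
  (forall z, U z -> f z = g z) -> {for x, continuous f} -> {for x, continuous g}.
Proof.
move=> oU Ux fg cf; rewrite /prop_for /continuous_at -fg//.
apply: cvg_trans cf; apply: (@near_eq_cvg _ _ (nbhs x)); near=> z.
have Uz : U z by near: z; exact: open_nbhs_nbhs.
by rewrite fg.
Unshelve. all: by end_near. Qed.

Lemma Ck_ext k U f g : open U -> (forall x, U x -> f x = g x) ->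
  Ck k U f -> Ck k U g.
Proof.
move=> oU; elim: k f g => [|k IH] f g fg [cf df].
  split=> // x Ux; exact: continuous_open_eq oU Ux fg (cf x Ux).
split=> [x Ux|i]; first exact: continuous_open_eq oU Ux fg (cf x Ux).
have [df1 df2] := df i; split.
  move=> x Ux; apply: (near_eq_derivable (open_near_eq oU Ux fg)); exact: df1.
apply: (IH (partial i f)) => // x Ux.
by apply: near_eq_derive; exact: (open_near_eq oU Ux fg).
Qed.

(** The values of the derivatives matter on [U] only, where they are [F i]; this
    is the induction step of all the closure properties below. *)
Lemma Ck_step k U f (F : 'I_n -> E -> R) : open U ->
  (forall x, U x -> {for x, continuous f}) ->
  (forall i x, U x -> is_derive x (delta_mx 0 i) f (F i x)) ->
  (forall i, Ck k U (F i)) -> Ck k.+1 U f.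
Proof.
move=> oU cf df CF; split=> // i; split=> [x Ux|]; first by case: (df i x Ux).
apply: (Ck_ext oU _ (CF i)) => x Ux; by case: (df i x Ux).
Qed.

Lemma Ck_cst k U (c : R) : open U -> Ck k U (fun=> c).
Proof.
move=> oU; elim: k c => [|k IH] c; first by split=> // x _; exact: cst_continuous.
apply: (Ck_step oU (F := fun _ _ => 0)) => [x _|i].
- exact: cst_continuous.
- exact: IH.
Qed.

Lemma is_derive_coord x v j : is_derive x v (fun z : E => z 0 j) (v 0 j).
Proof.
have dc : differentiable (fun z : E => z 0 j : R) x by exact: differentiable_coord.
apply: DeriveDef; first exact: diff_derivable.
rewrite /derive; apply/cvg_lim => //; apply: cvg_near_cst; near=> h.
have h0 : h != 0 by near: h; exact: nbhs_dnbhs_neq.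
by rewrite /= !mxE addrK [_ *: _]mulKf.
Unshelve. all: by end_near. Qed.

Lemma Ck_coord k U j : open U -> Ck k U (fun x => x 0 j).
Proof.
move=> oU; case: k => [|k]; first by split=> // x _; exact: coord_continuous.
apply: (Ck_step oU (F := fun i _ => (delta_mx 0 i : E) 0 j)) => //.
- by move=> x _; exact: coord_continuous.
- by move=> i x _; exact: is_derive_coord.
- by move=> i; exact: Ck_cst.
Qed.

Lemma CkD k U f g : open U -> Ck k U f -> Ck k U g -> Ck k U (fun x => f x + g x).
Proof.
move=> oU; elim: k f g => [|k IH] f g Cf Cg.
  split=> // x Ux; exact: (continuousD (Ck_cont Cf Ux) (Ck_cont Cg Ux)).
apply: (Ck_step oU (F := fun i x => partial i f x + partial i g x)) => //.
- move=> x Ux; exact: (continuousD (Ck_cont Cf Ux) (Ck_cont Cg Ux)).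
- by move=> i x Ux; apply: is_deriveD; [exact: Ck_is_derive Cf Ux|exact: Ck_is_derive Cg Ux].
- by move=> i; apply: IH; exact: Ck_partial.
Qed.

Lemma CkM k U f g : open U -> Ck k U f -> Ck k U g -> Ck k U (fun x => f x * g x).
Proof.
move=> oU; elim: k f g => [|k IH] f g Cf Cg.
  split=> // x Ux; exact: (continuousM (Ck_cont Cf Ux) (Ck_cont Cg Ux)).
apply: (Ck_step oU (F := fun i x => f x * partial i g x + g x * partial i f x)) => //.
- move=> x Ux; exact: (continuousM (Ck_cont Cf Ux) (Ck_cont Cg Ux)).
- by move=> i x Ux; apply: is_deriveM; [exact: Ck_is_derive Cf Ux|exact: Ck_is_derive Cg Ux].
- by move=> i; apply: CkD => //; apply: IH; first [exact: CkS|exact: Ck_partial].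
Qed.

Lemma CkN k U f : open U -> Ck k U f -> Ck k U (fun x => - f x).
Proof.
move=> oU Cf; apply: (Ck_ext (f := fun x => (-1) * f x)) => //.
  by move=> x _; rewrite mulN1r.
by apply: CkM => //; exact: Ck_cst.
Qed.

Lemma CkB k U f g : open U -> Ck k U f -> Ck k U g -> Ck k U (fun x => f x - g x).
Proof. by move=> oU Cf Cg; apply: CkD => //; exact: CkN. Qed.

Lemma Ck_sum k U (I : Type) (s : seq I) (P : pred I) (F : I -> E -> R) : open U ->
  (forall i, Ck k U (F i)) -> Ck k U (fun x => \sum_(i <- s | P i) F i x).
Proof.
move=> oU CF; elim: s => [|i s IH].
  by apply: (Ck_ext (f := fun=> 0)) => //; [move=> x _; rewrite big_nil|exact: Ck_cst].
apply: (Ck_ext (f := fun x => (if P i then F i x else 0) + \sum_(i <- s | P i) F i x)) => //.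
  by move=> x _; rewrite big_cons; case: (P i); rewrite ?add0r.
by apply: CkD => //; case: (P i) => //; exact: Ck_cst.
Qed.

Lemma Ck_prod k U (I : Type) (s : seq I) (P : pred I) (F : I -> E -> R) : open U ->
  (forall i, Ck k U (F i)) -> Ck k U (fun x => \prod_(i <- s | P i) F i x).
Proof.
move=> oU CF; elim: s => [|i s IH].
  by apply: (Ck_ext (f := fun=> 1)) => //; [move=> x _; rewrite big_nil|exact: Ck_cst].
apply: (Ck_ext (f := fun x => (if P i then F i x else 1) * \prod_(i <- s | P i) F i x)) => //.
  by move=> x _; rewrite big_cons; case: (P i); rewrite ?mul1r.
by apply: CkM => //; case: (P i) => //; exact: Ck_cst.
Qed.

Lemma CkV k U f : open U -> (forall x, U x -> f x != 0) -> Ck k U f ->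
  Ck k U (fun x => (f x)^-1).
Proof.
move=> oU f0; elim: k => [|k IH] Cf.
  by split=> // x Ux; exact: (continuousV (f0 x Ux) (Ck_cont Cf Ux)).
apply: (Ck_step oU (F := fun i x => - ((f x)^-1 * (f x)^-1) * partial i f x)) => //.
- by move=> x Ux; exact: (continuousV (f0 x Ux) (Ck_cont Cf Ux)).
- move=> i x Ux; apply: DeriveDef.
    by apply: derivableV; [exact: f0|exact: Ck_derivable Cf Ux].
  rewrite deriveV; [|exact: f0|exact: Ck_derivable Cf Ux].
  by rewrite -invfM -expr2.
- move=> i; have IHf := IH (CkS Cf); apply: CkM => //; last exact: Ck_partial.
  by apply: CkN => //; exact: CkM.
Qed.

Lemma Ck_expR k U f : open U -> Ck k U f -> Ck k U (fun x => expR (f x)).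
Proof.
have cE x : Ck k U f -> U x -> {for x, continuous (fun z => expR (f z))}.
  move=> Cf Ux; apply: (@continuous_comp _ _ _ f (@expR R)); first exact: (Ck_cont Cf Ux).
  exact: continuous_expR.
move=> oU; elim: k cE => [|k IH] cE Cf; first by split=> // x; exact: cE.
apply: (Ck_step oU (F := fun i x => expR (f x) * partial i f x)) => //.
- by move=> x; exact: cE.
- move=> i x Ux; apply: is_derive_comp1; exact: Ck_is_derive Cf Ux.
- move=> i; apply: CkM => //; last exact: Ck_partial.
  apply: IH; last exact: CkS.
  by move=> x _; exact: cE.
Qed.

Lemma Ck_det k U m (A : E -> 'M[R]_m) : open U ->
  (forall i j, Ck k U (fun x => A x i j)) -> Ck k U (fun x => \det (A x)).
Proof.
move=> oU CA; apply: Ck_sum => // s; apply: CkM => //; first exact: Ck_cst.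
by apply: Ck_prod.
Qed.

Lemma Ck_adj k U m (A : E -> 'M[R]_m) i j : open U ->
  (forall i j, Ck k U (fun x => A x i j)) -> Ck k U (fun x => (\adj (A x)) i j).
Proof.
move=> oU CA.
apply: (Ck_ext (f := fun x => cofactor (A x) j i)) => //; first by move=> x _; rewrite mxE.
apply: CkM => //; first exact: Ck_cst.
apply: Ck_det => // k1 k2.
apply: (Ck_ext (f := fun x => A x (lift j k1) (lift i k2))) => //.
by move=> x _; rewrite !mxE.
Qed.

Lemma Ck_invmx k U m (A : E -> 'M[R]_m) i j : open U ->
  (forall x, U x -> A x \in unitmx) ->
  (forall i j, Ck k U (fun x => A x i j)) -> Ck k U (fun x => invmx (A x) i j).
Proof.
move=> oU uA CA.
apply: (Ck_ext (f := fun x => (\det (A x))^-1 * (\adj (A x)) i j)) => //.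
  by move=> x Ux; rewrite /invmx uA// [in RHS]mxE.
apply: CkM => //; last exact: Ck_adj.
apply: CkV => //; last exact: Ck_det.
by move=> x /uA; rewrite unitmxE unitfE.
Qed.

(** A $C^1$ function is derivable in every direction, with the expected
    derivative: directions are added one coordinate at a time. *)
Lemma Ck_is_derive_dir k U f x v : open U -> Ck k.+1 U f -> U x ->
  is_derive x v f (\sum_j v 0 j * partial j f x).
Proof.
move=> oU Cf Ux; rewrite {1}(row_sum_delta v).
elim: (index_enum _) => [|j s IH]; first by rewrite !big_nil; exact: is_derive0.
rewrite !big_cons [X in is_derive _ X]addrC [X in is_derive _ _ _ X]addrC.
have dj z : U z -> is_derive z (v 0 j *: delta_mx 0 j) f (v 0 j * partial j f z).
  by move=> Uz; apply: is_derive_scale; exact: Ck_is_derive Cf Uz.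
have dd z : U z -> derivable f z (v 0 j *: delta_mx 0 j) by move=> /dj[].
have cd : {for x, continuous ('D_(v 0 j *: delta_mx 0 j) f)}.
  apply: (continuous_open_eq (f := fun z => v 0 j * partial j f z) oU Ux).
    by move=> z Uz; have [_ ->] := dj z Uz.
  exact: (Ck_cont (CkM oU (Ck_cst k (v 0 j) oU) (Ck_partial j Cf)) Ux).
have [d1 <-] := IH; have [_ <-] := dj x Ux.
exact: (is_deriveD_dir oU Ux dd cd d1).
Qed.

Lemma partial_comm U f x i j : open U -> Ck 2 U f -> U x ->
  partial i (partial j f) x = partial j (partial i f) x.
Proof.
move=> oU Cf Ux; apply: (derive_comm oU Ux) => [z Uz|z Uz|z Uz|z Uz||].
- exact: (Ck_derivable Cf).
- exact: (Ck_derivable Cf).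
- exact: (Ck_derivable (Ck_partial j Cf)).
- exact: (Ck_derivable (Ck_partial i Cf)).
- exact: (Ck_cont (Ck_partial i (Ck_partial j Cf)) Ux).
- exact: (Ck_cont (Ck_partial j (Ck_partial i Cf)) Ux).
Qed.

End SmoothClosure.

(** * Bilinear forms, covectors and their variations *)

Section Forms.
Variables (R : realType) (n : nat).
Local Notation E := 'rV[R]_n.
Implicit Types (a : 'M[R]_n) (b u v w y : E) (da : 'I_n -> 'M[R]_n) (db : 'I_n -> E).

Definition bform a u v : R := \sum_(k < n) \sum_(l < n) a k l * u 0 k * v 0 l.
Definition covec b u : R := \sum_(k < n) b 0 k * u 0 k.
(** Below, [da k] and [db k] stand for the partial derivatives at a point of the
    metric and of the form; [dform] and [dcovec] are the derivatives in the
    direction of their first vector. *)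
Definition dform da u v w : R := \sum_(k < n) u 0 k * bform (da k) v w.
Definition dcovec db u v : R := \sum_(k < n) u 0 k * covec (db k) v.

Lemma covecD b u v : covec b (u + v) = covec b u + covec b v.
Proof. by rewrite -big_split; apply: eq_bigr => k _; rewrite mxE mulrDr. Qed.
Lemma covecZ b c u : covec b (c *: u) = c * covec b u.
Proof. by rewrite mulr_sumr; apply: eq_bigr => k _; rewrite mxE mulrCA. Qed.
Lemma covecC b u : covec b u = covec u b.
Proof. by apply: eq_bigr => k _; rewrite mulrC. Qed.
Lemma covec_delta b k : covec b (delta_mx 0 k) = b 0 k.
Proof.
rewrite /covec (bigD1 k)//= big1 ?addr0; first by rewrite mxE !eqxx mulr1.
by move=> j /negPf jk; rewrite mxE jk mulr0.
Qed.

Lemma covec0 b : covec b 0 = 0.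
Proof. by rewrite /covec big1// => k _; rewrite mxE mulr0. Qed.

Lemma bformE a u v : bform a u v = covec (u *m a) v.
Proof.
rewrite /bform exchange_big; apply: eq_bigr => l _; rewrite mxE mulr_suml.
by apply: eq_bigr => k _; rewrite [u 0 k * _]mulrC.
Qed.
Lemma bformDr a u v w : bform a u (v + w) = bform a u v + bform a u w.
Proof. by rewrite !bformE covecD. Qed.
Lemma bformZr a c u v : bform a u (c *: v) = c * bform a u v.
Proof. by rewrite !bformE covecZ. Qed.
Lemma bformDl a u v w : bform a (u + v) w = bform a u w + bform a v w.
Proof. by rewrite !bformE mulmxDl covecC covecD -!(covecC _ w). Qed.
Lemma bformZl a c u v : bform a (c *: u) v = c * bform a u v.
Proof. by rewrite !bformE -scalemxAl covecC covecZ covecC. Qed.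
Lemma bform0l a v : bform a 0 v = 0.
Proof. by rewrite -(scale0r (0 : E)) bformZl mul0r. Qed.
Lemma bform0r a v : bform a v 0 = 0.
Proof. by rewrite -(scale0r (0 : E)) bformZr mul0r. Qed.
Lemma bform_sym a u v : a^T = a -> bform a u v = bform a v u.
Proof.
move=> sa; rewrite /bform exchange_big; apply: eq_bigr => k _; apply: eq_bigr => l _.
by rewrite -{1}sa mxE mulrAC.
Qed.

Lemma dformDl da u v w x : dform da (u + v) w x = dform da u w x + dform da v w x.
Proof. by rewrite -big_split; apply: eq_bigr => k _; rewrite mxE mulrDl. Qed.
Lemma dformZl da c u v w : dform da (c *: u) v w = c * dform da u v w.
Proof. by rewrite mulr_sumr; apply: eq_bigr => k _; rewrite mxE mulrA. Qed.
Lemma dformDm da u v w x : dform da u (v + w) x = dform da u v x + dform da u w x.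
Proof. by rewrite -big_split; apply: eq_bigr => k _; rewrite bformDl mulrDr. Qed.
Lemma dformZm da c u v w : dform da u (c *: v) w = c * dform da u v w.
Proof. by rewrite mulr_sumr; apply: eq_bigr => k _; rewrite bformZl mulrCA. Qed.
Lemma dformDr da u v w x : dform da u v (w + x) = dform da u v w + dform da u v x.
Proof. by rewrite -big_split; apply: eq_bigr => k _; rewrite bformDr mulrDr. Qed.
Lemma dformZr da c u v w : dform da u v (c *: w) = c * dform da u v w.
Proof. by rewrite mulr_sumr; apply: eq_bigr => k _; rewrite bformZr mulrCA. Qed.
Lemma dform_sym da u v w : (forall k, (da k)^T = da k) -> dform da u v w = dform da u w v.
Proof. by move=> sa; apply: eq_bigr => k _; rewrite bform_sym. Qed.
Lemma dform_delta da l v w : dform da (delta_mx 0 l) v w = bform (da l) v w.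
Proof.
rewrite /dform (bigD1 l)//= big1 ?addr0; first by rewrite mxE !eqxx mul1r.
by move=> j /negPf jk; rewrite mxE jk mul0r.
Qed.
Lemma dcovecDl db u v w : dcovec db (u + v) w = dcovec db u w + dcovec db v w.
Proof. by rewrite -big_split; apply: eq_bigr => k _; rewrite mxE mulrDl. Qed.
Lemma dcovecZl db c u v : dcovec db (c *: u) v = c * dcovec db u v.
Proof. by rewrite mulr_sumr; apply: eq_bigr => k _; rewrite mxE mulrA. Qed.
Lemma dcovecDr db u v w : dcovec db u (v + w) = dcovec db u v + dcovec db u w.
Proof. by rewrite -big_split; apply: eq_bigr => k _; rewrite covecD mulrDr. Qed.
Lemma dcovecZr db c u v : dcovec db u (c *: v) = c * dcovec db u v.
Proof. by rewrite mulr_sumr; apply: eq_bigr => k _; rewrite covecZ mulrCA. Qed.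
Lemma dcovec_delta db l v : dcovec db (delta_mx 0 l) v = covec (db l) v.
Proof.
rewrite /dcovec (bigD1 l)//= big1 ?addr0; first by rewrite mxE !eqxx mul1r.
by move=> j /negPf jk; rewrite mxE jk mul0r.
Qed.

Lemma linear_expand (L : E -> R) v : (forall u w, L (u + w) = L u + L w) ->
  (forall c u, L (c *: u) = c * L u) -> L v = \sum_j v 0 j * L (delta_mx 0 j).
Proof.
move=> LD LZ; have L0 : L 0 = 0 by rewrite -(scale0r 0) LZ mul0r.
by rewrite {1}(row_sum_delta v) (big_morph L LD L0); apply: eq_bigr => j _; rewrite LZ.
Qed.

Lemma is_derive_bigsum m (h : 'I_m -> E -> R) y v (dh : 'I_m -> R) :
  (forall i, is_derive y v (h i) (dh i)) ->
  is_derive y v (fun z => \sum_(i < m) h i z) (\sum_(i < m) dh i).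
Proof.
move=> hh; have -> : (fun z => \sum_(i < m) h i z) = \sum_(i < m) h i.
  by apply/funext => z; rewrite fct_sumE.
exact: is_derive_sum.
Qed.

Lemma is_derive_covec b y v : is_derive y v (covec b) (covec b v).
Proof.
apply: is_derive_bigsum => k.
apply: is_derive_eq (is_deriveM (is_derive_cst (b 0 k) _ _) (is_derive_coord y v k)) _.
by rewrite scaler0 addr0.
Qed.

Lemma is_derive_bform a y v : a^T = a ->
  is_derive y v (fun z => bform a z z) (2 * bform a y v).
Proof.
move=> sa; have -> : (fun z => bform a z z) =
   (fun z => \sum_k \sum_l a k l * (z 0 k * z 0 l)).
  by apply/funext => z; apply: eq_bigr => k _; apply: eq_bigr => l _; rewrite mulrA.
have -> : 2 * bform a y v = \sum_k \sum_l a k l * (y 0 k * v 0 l + y 0 l * v 0 k).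
  rewrite mulr2n mulrDl mul1r {2}bform_sym// /bform -big_split; apply: eq_bigr => k _.
  rewrite -big_split; apply: eq_bigr => l _ /=; ring.
apply: is_derive_bigsum => k; apply: is_derive_bigsum => l.
apply: is_derive_eq (is_deriveM (is_derive_cst (a k l) _ _)
  (is_deriveM (is_derive_coord y v k) (is_derive_coord y v l))) _.
by rewrite scaler0 addr0.
Qed.

Lemma is_derive_bformr a u y v : is_derive y v (fun z => bform a z u) (bform a v u).
Proof.
have E1 w : bform a w u = covec (u *m a^T) w.
  rewrite /bform; apply: eq_bigr => k _; rewrite mxE mulr_suml; apply: eq_bigr => l _.
  by rewrite mxE; ring.
rewrite E1; have -> : (fun z => bform a z u) = covec (u *m a^T) by apply/funext.
exact: is_derive_covec.
Qed.
End Forms.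

Section MetricDerivatives.
Variables (R : realType) (n : nat).
Local Notation E := 'rV[R]_n.

Lemma is_derive_sqr (f : E -> R) x v (d : R) : is_derive x v f d ->
  is_derive x v (fun z => f z ^+ 2) (2 * f x * d).
Proof.
move=> h; apply: is_derive_eq (is_deriveM h h) _.
by rewrite /GRing.scale /=; ring.
Qed.

Lemma is_derive_ratio (A b : E -> R) (x v : E) (dA db : R) : b x != 0 ->
  is_derive x v A dA -> is_derive x v b db ->
  is_derive x v (fun z => A z / b z ^+ 2)
    (dA / b x ^+ 2 - 2 * A x * db / b x ^+ 3).
Proof.
move=> b0 hA hb.
have b20 : b x ^+ 2 != 0 by rewrite expf_neq0.
have [d1 d2] := is_derive_sqr hb.
have hV : is_derive x v (fun z => (b z ^+ 2)^-1) (- (b x ^+ 2) ^- 2 * (2 * b x * db)).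
  apply: DeriveDef; first exact: (@derivableV _ _ (fun z => b z ^+ 2) x v b20 d1).
  by rewrite (@deriveV _ _ (fun z => b z ^+ 2) x v b20 d1) d2.
apply: is_derive_eq (is_deriveM hA hV) _.
rewrite /GRing.scale /=; field; exact: b0.
Qed.

(** This serves along the fibre, where $A$ and $\beta$ vary with the vector, and
    along the base, where their coefficients vary. *)
Lemma is_derive_exp_metric (A b : E -> R) (x v : E) (e dA db : R) : b x != 0 ->
  is_derive x v A dA -> is_derive x v b db ->
  is_derive x v (fun z => b z * expR (e * (A z / b z ^+ 2)))
    (expR (e * (A x / b x ^+ 2)) * (db + e * (dA / b x - 2 * A x * db / b x ^+ 2))).
Proof.
move=> b0 hA hb; have hq := is_derive_ratio b0 hA hb.
have he := is_derive_comp1 (is_derive_expR _) (is_deriveM (is_derive_cst e x v) hq).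
apply: is_derive_eq (is_deriveM hb he) _.
rewrite /GRing.scale /= /cst; field; exact: b0.
Qed.
End MetricDerivatives.

(** * The equation satisfied by the spray *)

Section SprayEquation.
Variables (R : realType) (n : nat).
Local Notation E := 'rV[R]_n.
Variables (e : R) (a : 'M[R]_n) (b : E).
Hypothesis sa : a^T = a.
Implicit Types (u v w y : E).

(** The exponential factor of the norm; here $\epsilon$ is [e]. *)
Definition gauge y : R := expR (e * (bform a y y / covec b y ^+ 2)).
Definition exp_norm y : R := covec b y * gauge y.

Lemma gauge_gt0 y : 0 < gauge y. Proof. exact: expR_gt0. Qed.

(** The first variation of $F^2 = \beta^2 e^{2\epsilon A/\beta^2}$ when $A$ and
    $\beta$ vary by [P] and [Q]. *)
Definition sqvar y (P Q : R) : R :=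
  gauge y ^+ 2 * (2 * e * P + (2 - 4 * e * (bform a y y / covec b y ^+ 2)) * covec b y * Q).

(** The derivative of [sqvar] in the direction [v] of the fibre, when [P] and
    [Q] change at rates [P'] and [Q']. *)
Definition sqvar2 y v (P Q P' Q' : R) : R :=
  let q := bform a y y / covec b y ^+ 2 in
  let dq := 2 * bform a y v / covec b y ^+ 2
            - 2 * bform a y y * covec b v / covec b y ^+ 3 in
  gauge y ^+ 2 *
    (2 * e * dq * (2 * e * P + (2 - 4 * e * q) * covec b y * Q)
     + 2 * e * P' - 4 * e * dq * covec b y * Q
     + (2 - 4 * e * q) * (covec b v * Q + covec b y * Q')).

Lemma is_derive_gauge y v : covec b y != 0 ->
  is_derive y v gauge (gauge y * (e * (2 * bform a y v / covec b y ^+ 2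
            - 2 * bform a y y * covec b v / covec b y ^+ 3))).
Proof.
move=> b0; have hq := is_derive_ratio b0 (is_derive_bform y v sa) (is_derive_covec b y v).
have he := is_derive_comp1 (is_derive_expR _) (is_deriveM (is_derive_cst e y v) hq).
apply: is_derive_eq he _.
by rewrite /GRing.scale /= /cst mulr0 addr0.
Qed.

Lemma is_derive_sqvar (P Q : E -> R) y v (P' Q' : R) : covec b y != 0 ->
  is_derive y v P P' -> is_derive y v Q Q' ->
  is_derive y v (fun z => sqvar z (P z) (Q z)) (sqvar2 y v (P y) (Q y) P' Q').
Proof.
move=> b0 hP hQ.
have hq := is_derive_ratio b0 (is_derive_bform y v sa) (is_derive_covec b y v).
have hb := is_derive_covec b y v.
have hg := is_derive_sqr (is_derive_gauge v b0).
have h1 := is_deriveM (is_derive_cst (2 * e) y v) hP.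
have h2 := is_deriveB (is_derive_cst (2 : R) y v) (is_deriveM (is_derive_cst (4 * e) y v) hq).
have h3 := is_deriveM (is_deriveM h2 hb) hQ.
apply: is_derive_eq (is_deriveM hg (is_deriveD h1 h3)) _.
rewrite /sqvar2 /GRing.scale /= !fctE /cst /=; ring.
Qed.

Lemma sqvar2E y v P Q P' Q' : sqvar2 y v P Q P' Q' =
  sqvar2 y v 1 0 0 0 * P + sqvar2 y v 0 1 0 0 * Q
  + sqvar2 y v 0 0 1 0 * P' + sqvar2 y v 0 0 0 1 * Q'.
Proof. rewrite /sqvar2; ring. Qed.

Lemma open_covec_gt0 : open [set y | 0 < covec b y].
Proof.
apply: (@open_comp _ _ (covec b) [set t | 0 < t]); last exact: open_gt.
move=> y _; suff : {for y, continuous (covec b)} by [].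
have Cc : Ck 0 setT (fun y => \sum_(k < n) b 0 k * y 0 k).
  apply: Ck_sum; first exact: openT.
  by move=> k; apply: CkM; [exact: openT|apply: Ck_cst; exact: openT|apply: Ck_coord; exact: openT].
exact: (Ck_cont Cc).
Qed.

Variables (da : 'I_n -> 'M[R]_n) (db : 'I_n -> E).
Hypothesis sda : forall k, (da k)^T = da k.
Variables (F : E -> E -> R) (x : E).
Hypothesis hF : forall y, F x y = exp_norm y.
Hypothesis hdx : forall k y, 0 < covec b y ->
  dx k (Fsq F) x y = sqvar y (bform (da k) y y) (covec (db k) y).

(** The second derivative of $F^2$ along the fibre; it is twice the fundamental
    tensor. *)
Definition hessian y w v : R :=
  sqvar2 y w (2 * bform a y v) (covec b v) (2 * bform a w v) 0.

(** The Euler-Lagrange covector of $F^2$, paired with [w]: the derivative of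
    $F^2$ along [y] in the base, differentiated along [w] in the fibre, minus the
    derivative of $F^2$ along [w] in the base. *)
Definition euler y w : R :=
  sqvar2 y w (dform da y y y) (dcovec db y y) (2 * dform da y y w) (dcovec db y w)
  - sqvar y (dform da w y y) (dcovec db w y).

Lemma is_derive_Fsq y v : 0 < covec b y ->
  is_derive y v (Fsq F x) (sqvar y (2 * bform a y v) (covec b v)).
Proof.
move=> b0; have bn0 : covec b y != 0 by rewrite gt_eqF.
have -> : Fsq F x = (fun z => (covec b z * gauge z) ^+ 2).
  by apply/funext => z; rewrite /Fsq hF.
have := is_derive_sqr (is_derive_exp_metric e bn0 (is_derive_bform y v sa) (is_derive_covec b y v)).
by move=> h; apply: is_derive_eq h _; rewrite /sqvar /gauge; field.
Qed.

Lemma fundamental_tensorE y i j : 0 < covec b y ->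
  fundamental_tensor F x y i j = 2^-1 * hessian y (delta_mx 0 j) (delta_mx 0 i).
Proof.
move=> b0; rewrite mxE; congr (_ * _).
have bn0 : covec b y != 0 by rewrite gt_eqF.
have h := is_derive_sqvar bn0 (is_deriveM (is_derive_cst (2 : R) y (delta_mx 0 j))
  (is_derive_bformr a (delta_mx 0 i) y (delta_mx 0 j)))
  (is_derive_cst (covec b (delta_mx 0 i)) y (delta_mx 0 j)).
have h2 := is_derive_open open_covec_gt0 b0 _ h.
have [|_] := h2 (dy i (Fsq F) x).
  by move=> z z0; have [_] := is_derive_Fsq (delta_mx 0 i) z0; rewrite /dy /partial => ->.
rewrite /dy /partial => ->; rewrite /hessian /GRing.scale /= /cst.
by rewrite mulr0 addr0.
Qed.

Lemma eulerE y l : 0 < covec b y ->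
  \sum_(k < n) dy l (dx k (Fsq F)) x y * y 0 k - dx l (Fsq F) x y = euler y (delta_mx 0 l).
Proof.
move=> b0; have bn0 : covec b y != 0 by rewrite gt_eqF.
rewrite hdx// /euler dform_delta dcovec_delta; congr (_ - _).
rewrite sqvar2E /dform /dcovec !mulr_sumr -!big_split; apply: eq_bigr => k _ /=.
have h := is_derive_sqvar bn0 (is_derive_bform y (delta_mx 0 l) (sda k))
   (is_derive_covec (db k) y (delta_mx 0 l)).
have [|_] := is_derive_open open_covec_gt0 b0 (g := dx k (Fsq F) x) _ h.
  by move=> z z0; rewrite hdx.
rewrite /dy /partial => ->; rewrite sqvar2E; ring.
Qed.

Lemma hessian_sym y w v : 0 < covec b y -> hessian y w v = hessian y v w.
Proof. by move=> b0; rewrite /hessian /sqvar2 (bform_sym w v sa); field; rewrite gt_eqF. Qed.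

Lemma hessianDl y v w w' : hessian y (w + w') v = hessian y w v + hessian y w' v.
Proof. rewrite /hessian /sqvar2 !bformDr bformDl !covecD; ring. Qed.

Lemma hessianZl y v c w : hessian y (c *: w) v = c * hessian y w v.
Proof. rewrite /hessian /sqvar2 bformZr bformZl !covecZ; ring. Qed.

Lemma eulerD y w w' : euler y (w + w') = euler y w + euler y w'.
Proof.
rewrite /euler /sqvar2 /sqvar bformDr dformDr dformDl dcovecDr dcovecDl covecD; ring.
Qed.

Lemma eulerZ y c w : euler y (c *: w) = c * euler y w.
Proof.
rewrite /euler /sqvar2 /sqvar bformZr dformZr dformZl dcovecZr dcovecZl covecZ; ring.
Qed.

Definition spray_vec y : E := \row_i spray_coef F i x y.

Lemma hessian_expand y w v : 0 < covec b y -> hessian y w v =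
  \sum_i \sum_j w 0 i * v 0 j * hessian y (delta_mx 0 j) (delta_mx 0 i).
Proof.
move=> b0; rewrite (linear_expand (L := fun w => hessian y w v)).
- apply: eq_bigr => i _; rewrite hessian_sym//.
  rewrite (linear_expand (L := fun v => hessian y v (delta_mx 0 i))).
  + by rewrite mulr_sumr; apply: eq_bigr => j _; rewrite mulrA.
  + by move=> u u'; exact: hessianDl.
  + by move=> c u; exact: hessianZl.
- by move=> u u'; exact: hessianDl.
- by move=> c u; exact: hessianZl.
Qed.

(** The spray is defined through the inverse of the fundamental tensor; in this
    implicit form no inverse occurs, and the vector [w] can be chosen freely. *)
Lemma hessian_spray y w : 0 < covec b y -> fundamental_tensor F x y \in unitmx ->
  hessian y w (2 *: spray_vec y) = euler y w.
Proof.
move=> b0 ug; set g := fundamental_tensor F x y in ug.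
pose c : 'cV[R]_n := \col_l euler y (delta_mx 0 l).
have E1 : (spray_vec y)^T = 4^-1 *: (invmx g *m c).
  apply/colP => i; rewrite !mxE /spray_coef; congr (_ * _).
  by apply: eq_bigr => l _; rewrite eulerE// mxE.
have E2 : g *m (spray_vec y)^T = 4^-1 *: c by rewrite E1 -scalemxAr mulKVmx.
rewrite (linear_expand (L := euler y) w (eulerD y) (eulerZ y)).
rewrite hessian_expand//; apply: eq_bigr => i _.
have := congr1 (fun m : 'cV[R]_n => m i 0) E2; rewrite !mxE => E3.
have -> : euler y (delta_mx 0 i) = 4 * (4^-1 * euler y (delta_mx 0 i)) by field.
rewrite -E3 !mulr_sumr; apply: eq_bigr => j _.
by rewrite fundamental_tensorE// !mxE; field.
Qed.

Lemma regular_of_nondegenerate y : 0 < covec b y ->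
  (forall v, (forall w, hessian y w v = 0) -> v = 0) ->
  fundamental_tensor F x y \in unitmx.
Proof.
move=> b0 nd; rewrite unitmxE unitfE; apply/negP => /det0P[v v0 vg].
case/eqP: v0; apply: nd => w; rewrite hessian_sym// hessian_expand// exchange_big big1// => j _.
have := congr1 (fun m : E => m 0 j) vg; rewrite !mxE => vgj.
transitivity (2 * w 0 j * 0); last by rewrite mulr0.
rewrite -[X in _ = _ * X]vgj mulr_sumr; apply: eq_bigr => i _ /=.
by rewrite fundamental_tensorE//; field.
Qed.
End SprayEquation.

(** * The spray equation in a plane *)

Section PlaneAlgebra.
Variable R : realType.
Implicit Types (e u Z P Q : R).

(** Up to the square of the exponential factor, [hessX] and [hessz] are the Hessian
    at $X + uz$ of a vector $v$ with $\beta(v) = P$ and $\langle z, v\rangle = Q$,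
    paired with $X$ and with $z$; here $Z = |z|^2$. *)
Definition hessX e u Z P Q : R :=
  let A := 1 + u ^+ 2 * Z in
  2 * e * (2 - 2 * A) * (4 * e * (P + u * Q) + (2 - 4 * e * A) * P)
  + 4 * e * P - 4 * e * (2 - 2 * A) * P + (2 - 4 * e * A) * P.

Definition hessz e u Z P Q : R :=
  let A := 1 + u ^+ 2 * Z in
  2 * e * (2 * u * Z) * (4 * e * (P + u * Q) + (2 - 4 * e * A) * P)
  + 4 * e * Q - 4 * e * (2 * u * Z) * P.

(** The determinant of the system is $8\epsilon(1 + 2\epsilon u^2Z)$. *)
Lemma plane_kernel e u Z P Q : e ^+ 2 = 1 -> 1 + 2 * e * u ^+ 2 * Z != 0 ->
  hessX e u Z P Q = 0 -> hessz e u Z P Q = 0 -> P = 0 /\ Q = 0.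
Proof.
move=> e2 D0 HX Hz.
have PE : 8 * e * (1 + 2 * e * u ^+ 2 * Z) * P =
    (4 * e + 16 * u ^+ 2 * Z) * hessX e u Z P Q
    + 16 * u * (u ^+ 2 * Z) * hessz e u Z P Q.
  by move/eqP: e2; rewrite sqrf_eq1 /hessX /hessz => /orP[] /eqP ->; ring.
have QE : 8 * e * (1 + 2 * e * u ^+ 2 * Z) * Q =
    (16 * (u ^+ 2 * Z) ^+ 2 + 2 - 4 * e * (u ^+ 2 * Z)) * hessz e u Z P Q
    + 16 * u * Z * (u ^+ 2 * Z) * hessX e u Z P Q.
  by move/eqP: e2; rewrite sqrf_eq1 /hessX /hessz => /orP[] /eqP ->; ring.
have e0 : e != 0 by rewrite -sqrf_eq0 e2 oner_eq0.
have d0 : 8 * e * (1 + 2 * e * u ^+ 2 * Z) != 0 by rewrite !mulf_neq0// pnatr_eq0.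
by split; apply: (mulfI d0); rewrite ?PE ?QE HX Hz !mulr0 addr0.
Qed.

(** For the partial derivatives named as in [plane_solution] and a unit form,
    [rho] is $(\nabla\beta)(z,z)$ and [sig] is $\frac12 d\beta(z,X)$. *)
Definition rho (t3 t5 s4 : R) := s4 - t5 + t3 / 2.
Definition sig (s2 s3 : R) := (s3 - s2) / 2.

(** Here [t2], [t3], [t5], [t6] are the derivatives of the metric and [s1] to [s4]
    those of the form, evaluated on $X$ and $z$; that $t_1 = 2s_1$ and
    $t_4 = 2s_3$ is the derivative of $|\beta| = 1$.  The proposed solution is
    checked, and it is the only one by [plane_kernel]. *)
Lemma plane_solution e u Z P Q t2 t3 t5 t6 s1 s2 s3 s4 :
  e ^+ 2 = 1 -> 1 + 2 * e * u ^+ 2 * Z != 0 ->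
  let t1 := 2 * s1 in let t4 := 2 * s3 in
  let A := 1 + u ^+ 2 * Z in
  let TT := t1 + 2 * u * t2 + u ^+ 2 * t3 + u * t4 + 2 * u ^+ 2 * t5 + u ^+ 3 * t6 in
  let SS := s1 + u * s2 + u * s3 + u ^+ 2 * s4 in
  hessX e u Z P Q =
    2 * e * (2 - 2 * A) * (2 * e * TT + (2 - 4 * e * A) * SS)
    + 4 * e * (t1 + u * t2 + u * t4 + u ^+ 2 * t5) - 4 * e * (2 - 2 * A) * SS
    + (2 - 4 * e * A) * (SS + (s1 + u * s3))
    - (2 * e * (t1 + 2 * u * t2 + u ^+ 2 * t3) + (2 - 4 * e * A) * (s1 + u * s2)) ->
  hessz e u Z P Q =
    2 * e * (2 * u * Z) * (2 * e * TT + (2 - 4 * e * A) * SS)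
    + 4 * e * (t2 + u * t3 + u * t5 + u ^+ 2 * t6) - 4 * e * (2 * u * Z) * SS
    + (2 - 4 * e * A) * (s2 + u * s4)
    - (2 * e * (t4 + 2 * u * t5 + u ^+ 2 * t6) + (2 - 4 * e * A) * (s3 + u * s4)) ->
  let N := u ^+ 2 * rho t3 t5 s4 + (2 * u ^+ 2 * Z - e) * u * sig s2 s3 in
  let D := 1 + 2 * e * u ^+ 2 * Z in
  P = SS - 2 * e * N / D /\
  Q = t2 - t4 / 2 + u * t3 + u ^+ 2 / 2 * t6 + (2 + 2 * u ^+ 2 * Z - e) * sig s2 s3
      - 4 * e * u * Z * N / D.
Proof.
move=> e2 D0 t1 t4 A TT SS HX Hz N D.
set P0 := (X in P = X); set Q0 := (X in Q = X).
have [||] := @plane_kernel e u Z (P - P0) (Q - Q0) e2 D0; last first.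
- by move=> /eqP + /eqP; rewrite !subr_eq0 => /eqP -> /eqP ->.
- have -> : hessz e u Z (P - P0) (Q - Q0) = hessz e u Z P Q - hessz e u Z P0 Q0.
    by rewrite /hessz; ring.
  rewrite Hz; apply/eqP; rewrite subr_eq0; apply/eqP.
  rewrite /hessX /hessz /P0 /Q0 /N /D /t1 /t4 /TT /SS /A /t1 /t4 /rho /sig.
  by move/eqP: e2 D0; rewrite sqrf_eq1 => /orP[] /eqP -> D0; field; move: D0; congr (~~ (_ == _)); ring.
- have -> : hessX e u Z (P - P0) (Q - Q0) = hessX e u Z P Q - hessX e u Z P0 Q0.
    by rewrite /hessX; ring.
  rewrite HX; apply/eqP; rewrite subr_eq0; apply/eqP.
  rewrite /hessX /hessz /P0 /Q0 /N /D /t1 /t4 /TT /SS /A /t1 /t4 /rho /sig.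
  by move/eqP: e2 D0; rewrite sqrf_eq1 => /orP[] /eqP -> D0; field; move: D0; congr (~~ (_ == _)); ring.
Qed.

End PlaneAlgebra.


(** * Rational functions on a line *)

Section OneVariable.
Variable R : realType.

(** Six values determine a polynomial of degree five. *)
Lemma quintic_eq0 (c0 c1 c2 c3 c4 c5 : R) :
  (forall t, 0 <= t <= 1 -> c0 + c1 * t + c2 * t ^+ 2 + c3 * t ^+ 3 + c4 * t ^+ 4
      + c5 * t ^+ 5 = 0) ->
  [/\ c0 = 0, c1 = 0 & c2 = 0] /\ [/\ c3 = 0, c4 = 0 & c5 = 0].
Proof.
move=> h.
have h0 : c0 + c1 * 0 + c2 * 0 ^+ 2 + c3 * 0 ^+ 3 + c4 * 0 ^+ 4 + c5 * 0 ^+ 5 = 0 by apply: h; lra.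
have h1 := h (1 / 5) ltac:(lra).
have h2 := h (2 / 5) ltac:(lra).
have h3 := h (3 / 5) ltac:(lra).
have h4 := h (4 / 5) ltac:(lra).
have h5 := h 1 ltac:(lra).
by do 2!split; lra.
Qed.

Definition cubic_on_unit (f : R -> R) : Prop :=
  exists c0 c1 c2 c3 : R, forall t, 0 <= t <= 1 ->
    f t = c0 + c1 * t + c2 * t ^+ 2 + c3 * t ^+ 3.

Lemma cubic_sum (I : Type) (s : seq I) (f : I -> R -> R) :
  (forall i, cubic_on_unit (f i)) -> cubic_on_unit (fun t => \sum_(i <- s) f i t).
Proof.
move=> cf; elim: s => [|i s [c0 [c1 [c2 [c3 IH]]]]].
  by exists 0, 0, 0, 0 => t _; rewrite big_nil; ring.
have [d0 [d1 [d2 [d3 fi]]]] := cf i.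
exists (c0 + d0), (c1 + d1), (c2 + d2), (c3 + d3) => t tI.
by rewrite big_cons IH// fi//; ring.
Qed.

Lemma cubic_scale (k : R) (f : R -> R) : cubic_on_unit f ->
  cubic_on_unit (fun t => k * f t).
Proof.
move=> [d0 [d1 [d2 [d3 fi]]]]; exists (k * d0), (k * d1), (k * d2), (k * d3) => t tI.
by rewrite fi//; ring.
Qed.

Lemma cubic_line n (q : 'rV[R]_n -> R) (X z : 'rV[R]_n) : homogeneous_cubic q ->
  cubic_on_unit (fun t => q (X + t *: z)).
Proof.
case=> c qE; have : cubic_on_unit (fun t => \sum_k \sum_l \sum_m c k l m *
   (X + t *: z) 0 k * (X + t *: z) 0 l * (X + t *: z) 0 m).
  apply: cubic_sum => k; apply: cubic_sum => l; apply: cubic_sum => m.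
  exists (c k l m * X 0 k * X 0 l * X 0 m),
    (c k l m * (z 0 k * X 0 l * X 0 m + X 0 k * z 0 l * X 0 m + X 0 k * X 0 l * z 0 m)),
    (c k l m * (z 0 k * z 0 l * X 0 m + z 0 k * X 0 l * z 0 m + X 0 k * z 0 l * z 0 m)),
    (c k l m * z 0 k * z 0 l * z 0 m) => t _.
  by rewrite !mxE; ring.
case=> c0 [c1 [c2 [c3 h]]]; exists c0, c1, c2, c3 => t tI.
by rewrite qE -h.
Qed.

Definition quartic (c0 c1 c2 c3 c4 t : R) : R :=
  c0 + c1 * t + c2 * t ^+ 2 + c3 * t ^+ 3 + c4 * t ^+ 4.

Lemma is_derive_quartic c0 c1 c2 c3 c4 (t : R) :
  is_derive t 1 (quartic c0 c1 c2 c3 c4) (quartic c1 (2 * c2) (3 * c3) (4 * c4) 0 t).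
Proof.
have -> : quartic c0 c1 c2 c3 c4 = (fun t =>
    ((((cst c4 * id + cst c3) * id + cst c2) * id + cst c1) * id + cst c0) t).
  by apply/funext => u; rewrite /quartic !fctE /cst /=; ring.
have h4 := is_derive_cst c4 t (1 : R).
have h3 := is_deriveD (is_deriveM h4 (is_derive_id t 1)) (is_derive_cst c3 t (1 : R)).
have h2 := is_deriveD (is_deriveM h3 (is_derive_id t 1)) (is_derive_cst c2 t (1 : R)).
have h1 := is_deriveD (is_deriveM h2 (is_derive_id t 1)) (is_derive_cst c1 t (1 : R)).
have h0 := is_deriveD (is_deriveM h1 (is_derive_id t 1)) (is_derive_cst c0 t (1 : R)).
apply: is_derive_eq h0 _.
by rewrite /quartic /GRing.scale /= !fctE /cst /=; ring.
Qed.

(** The derivatives of a quotient $p/q$ are determined step by step from those of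
    [p] and [q], with no expansion of iterated quotients. *)
Lemma leibniz3 (U : set R) (f0 f1 f2 f3 : R -> R) (p p1 p2 p3 q q1 q2 q3 : R -> R) (t : R) :
  open U -> U t ->
  (forall s : R, is_derive s 1 p (p1 s)) -> (forall s : R, is_derive s 1 p1 (p2 s)) ->
  (forall s : R, is_derive s 1 p2 (p3 s)) ->
  (forall s : R, is_derive s 1 q (q1 s)) -> (forall s : R, is_derive s 1 q1 (q2 s)) ->
  (forall s : R, is_derive s 1 q2 (q3 s)) ->
  (forall s : R, U s -> is_derive s 1 f0 (f1 s)) ->
  (forall s : R, U s -> is_derive s 1 f1 (f2 s)) ->
  (forall s : R, U s -> is_derive s 1 f2 (f3 s)) ->
  (forall s, U s -> f0 s * q s = p s) ->
  [/\ f0 t * q t = p t, f1 t * q t + f0 t * q1 t = p1 t,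
     f2 t * q t + 2 * f1 t * q1 t + f0 t * q2 t = p2 t &
     f3 t * q t + 3 * f2 t * q1 t + 3 * f1 t * q2 t
       + f0 t * q3 t = p3 t].
Proof.
move=> oU Ut dp dp1 dp2 dq dq1 dq2 d0 d1 d2 e0.
have step (g r : R -> R) dr dg s : U s -> (forall s, U s -> g s = r s) ->
    is_derive s 1 r dr -> is_derive s 1 g dg -> dg = dr.
  move=> Us gr [_ <-] [_ <-].
  apply: near_eq_derive; near=> u; apply: gr; near: u; exact: open_nbhs_nbhs.
have e1 s : U s -> f1 s * q s + f0 s * q1 s = p1 s.
  move=> Us; apply: (step _ _ _ _ s Us e0 (dp s)).
  apply: is_derive_eq (is_deriveM (d0 s Us) (dq s)) _.
  by rewrite /GRing.scale /=; ring.
have e2 s : U s -> f2 s * q s + 2 * f1 s * q1 s + f0 s * q2 s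
    = p2 s.
  move=> Us; apply: (step _ _ _ _ s Us e1 (dp1 s)).
  apply: is_derive_eq (is_deriveD (is_deriveM (d1 s Us) (dq s))
    (is_deriveM (d0 s Us) (dq1 s))) _.
  by rewrite /GRing.scale /=; ring.
split; [exact: e0|exact: e1|exact: e2|].
apply: (step _ _ _ _ t Ut e2 (dp2 t)).
apply: is_derive_eq (is_deriveD (is_deriveD (is_deriveM (d2 t Ut) (dq t))
   (is_deriveM (is_deriveM (is_derive_cst (2 : R) t 1) (d1 t Ut)) (dq1 t)))
    (is_deriveM (d0 t Ut) (dq2 t))) _.
by rewrite /GRing.scale /= !fctE /cst /=; ring.
Unshelve. all: by end_near. Qed.

(** The function [f0] is $(1 - 2\epsilon Z)P + 2\epsilon Q$ for the solution $(P, Q)$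
    of the plane system.  As $1 - 2\epsilon Z + 4\epsilon tZ$ is
    $D(t) - 2\epsilon Z(t-1)^2$, it is a cubic plus $4Z(t-1)^2N(t)/D(t)$, and
    its third derivative at $1$ is a multiple of
    $\rho + (2Z - \epsilon)\sigma$. *)
Lemma landsberg_line (e Z s1 s2 s3 s4 t2 t3 t5 t6 : R) (U : set R) (f0 f1 f2 f3 : R -> R) :
  e ^+ 2 = 1 -> 0 < Z -> 1 + 2 * e * Z != 0 ->
  open U -> U 1 ->
  (forall s : R, U s -> is_derive s 1 f0 (f1 s)) ->
  (forall s : R, U s -> is_derive s 1 f1 (f2 s)) ->
  (forall s : R, U s -> is_derive s 1 f2 (f3 s)) ->
  (forall t, U t -> 1 + 2 * e * t ^+ 2 * Z != 0) ->
  let N t := t ^+ 2 * rho t3 t5 s4 + (2 * t ^+ 2 * Z - e) * t * sig s2 s3 in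
  let D t := 1 + 2 * e * t ^+ 2 * Z in
  (forall t, U t -> f0 t =
     (1 - 2 * e * Z) * (s1 + t * s2 + t * s3 + t ^+ 2 * s4 - 2 * e * N t / D t)
     + 2 * e * (t2 - 2 * s3 / 2 + t * t3 + t ^+ 2 / 2 * t6
                + (2 + 2 * t ^+ 2 * Z - e) * sig s2 s3 - 4 * e * t * Z * N t / D t)) ->
  f3 1 = 0 -> rho t3 t5 s4 + (2 * Z - e) * sig s2 s3 = 0.
Proof.
move=> e2 Z0 D1 oU U1 d0 d1 d2 DU N D fE f30.
pose si := sig s2 s3; pose r := rho t3 t5 s4.
pose q0 := t2 - s3 + (2 - e) * si; pose q2 := t6 / 2 + 2 * Z * si.
pose k := 1 - 2 * e * Z.
pose c0 := k * s1 + 2 * e * q0.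
pose c1 := k * (s2 + s3 + 2 * e ^+ 2 * si) + 2 * e * t3.
pose c2 := k * (s4 + 2 * e * Z * s1 - 2 * e * r)
           + 2 * e * (q2 + 2 * e * Z * q0 + 4 * e ^+ 2 * Z * si).
pose c3 := k * (2 * e * Z * (s2 + s3) - 4 * e * Z * si)
           + 2 * e * (2 * e * Z * t3 - 4 * e * Z * r).
pose c4 := k * (2 * e * Z * s4) + 2 * e * (2 * e * Z * q2 - 8 * e * Z ^+ 2 * si).
have e0 s : U s -> f0 s * quartic 1 0 (2 * e * Z) 0 0 s = quartic c0 c1 c2 c3 c4 s.
  move=> Us; rewrite fE// /quartic /c0 /c1 /c2 /c3 /c4 /q0 /q2 /k /N /D -/si -/r.
  by field; exact: DU.
have [h0 h1 h2 h3] := leibniz3 oU U1 (is_derive_quartic _ _ _ _ _)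
  (is_derive_quartic _ _ _ _ _) (is_derive_quartic _ _ _ _ _)
  (is_derive_quartic _ _ _ _ _) (is_derive_quartic _ _ _ _ _)
  (is_derive_quartic _ _ _ _ _) d0 d1 d2 e0.
move: h0 h1 h2 h3; rewrite f30 -/si -/r; clear fE e0.
move: (f0 1) (f1 1) (f2 1) => g0 g1 g2.
set d := 1 + 2 * e * Z in D1.
rewrite /quartic => h0 h1 h2 h3.
have g0E : g0 = (c0 + c1 + c2 + c3 + c4) / d.
  by apply: (mulIf D1); rewrite divfK// /d; lra.
have g1E : g1 = (c1 + 2 * c2 + 3 * c3 + 4 * c4 - g0 * (4 * e * Z)) / d.
  by apply: (mulIf D1); rewrite divfK// /d; lra.
have g2E : g2 = (2 * c2 + 6 * c3 + 12 * c4 - 2 * g1 * (4 * e * Z) - g0 * (4 * e * Z)) / d.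
  by apply: (mulIf D1); rewrite divfK// /d; lra.
have g3E : 6 * c3 + 24 * c4 - 3 * g2 * (4 * e * Z) - 3 * g1 * (4 * e * Z) = 0 by lra.
have H : 48 * Z * (r + (2 * Z - e) * si) = 0.
  rewrite -(mul0r d) -g3E g2E g1E g0E.
  rewrite /c0 /c1 /c2 /c3 /c4 /q0 /q2 /k /d; rewrite /d in D1.
  clear -e2 D1; move/eqP: e2 D1; rewrite sqrf_eq1 => /orP[] /eqP -> D1; field;
  move: D1; congr (~~ (_ == _)); ring.
have Z48 : 48 * Z != 0 by rewrite mulf_neq0// ?pnatr_eq0// gt_eqF.
by apply: (mulfI Z48); rewrite mulr0.
Qed.
End OneVariable.

(** * Third derivatives along a line *)

Section LineDerivative.
Variables (R : realType) (n : nat).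
Local Notation E := 'rV[R]_n.
Implicit Types (f g : E -> R) (U : set E) (z y : E).

(** Unlike ['D_z f], this is linear in [z] without any assumption on [f]. *)
Definition dirderiv z f y : R := \sum_j z 0 j * partial j f y.

Lemma partial_open_eq U f g j y : open U -> (forall w, U w -> f w = g w) -> U y ->
  partial j f y = partial j g y.
Proof.
by move=> oU fg Uy; apply: near_eq_derive; exact: (open_near_eq oU Uy fg).
Qed.

Lemma dirderiv_open_eq U z f g y : open U -> (forall w, U w -> f w = g w) -> U y ->
  dirderiv z f y = dirderiv z g y.
Proof.
by move=> oU fg Uy; apply: eq_bigr => j _; rewrite (partial_open_eq j oU fg Uy).
Qed.

Lemma Ck_dirderiv k U z f : open U -> Ck k.+1 U f -> Ck k U (dirderiv z f).
Proof.
move=> oU Cf; apply: Ck_sum => // j; apply: CkM => //; first exact: Ck_cst.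
exact: Ck_partial.
Qed.

Lemma partial_sum k U m (c : 'I_m -> R) (f : 'I_m -> E -> R) j y : open U ->
  (forall i, Ck k.+1 U (f i)) -> U y ->
  partial j (fun w => \sum_i c i * f i w) y = \sum_i c i * partial j (f i) y.
Proof.
move=> oU Cf Uy.
have h : is_derive y (delta_mx 0 j) (fun w => \sum_i c i * f i w)
    (\sum_i c i * partial j (f i) y).
  apply: is_derive_bigsum => i.
  apply: is_derive_eq (is_deriveM (is_derive_cst (c i) y _) (Ck_is_derive j (Cf i) Uy)) _.
  by rewrite scaler0 addr0.
by case: h.
Qed.

Lemma dirderiv_sum k U m z (c : 'I_m -> R) (f : 'I_m -> E -> R) y : open U ->
  (forall i, Ck k.+1 U (f i)) -> U y ->
  dirderiv z (fun w => \sum_i c i * f i w) y = \sum_i c i * dirderiv z (f i) y.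
Proof.
move=> oU Cf Uy; rewrite /dirderiv.
under eq_bigr => j _ do rewrite (partial_sum c j oU Cf Uy) mulr_sumr.
rewrite exchange_big; apply: eq_bigr => i _; rewrite mulr_sumr.
by apply: eq_bigr => j _; rewrite mulrCA.
Qed.

Lemma dirderiv3_sum U m z (c : 'I_m -> R) (f : 'I_m -> E -> R) y : open U ->
  (forall i, Ck 3 U (f i)) -> U y ->
  dirderiv z (dirderiv z (dirderiv z (fun w => \sum_i c i * f i w))) y =
  \sum_i c i * dirderiv z (dirderiv z (dirderiv z (f i))) y.
Proof.
move=> oU Cf Uy.
have C1 i := Ck_dirderiv z oU (Cf i); have C2 i := Ck_dirderiv z oU (C1 i).
rewrite -(dirderiv_sum z c oU C2 Uy); apply: (dirderiv_open_eq z oU) => // w Uw.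
rewrite -(dirderiv_sum z c oU C1 Uw); apply: (dirderiv_open_eq z oU) => // v Uv.
exact: (dirderiv_sum z c oU Cf Uv).
Qed.

Lemma dirderiv3E U z f y : open U -> Ck 3 U f -> U y ->
  dirderiv z (dirderiv z (dirderiv z f)) y =
  \sum_l \sum_k \sum_j z 0 l * z 0 k * z 0 j * partial l (partial k (partial j f)) y.
Proof.
move=> oU Cf Uy; apply: eq_bigr => l _.
have C1 j := Ck_partial j Cf; have C2 k j := Ck_partial k (C1 j).
have E1 w : U w -> dirderiv z (dirderiv z f) w =
    \sum_k z 0 k * \sum_j z 0 j * partial k (partial j f) w.
  by move=> Uw; apply: eq_bigr => k _; rewrite (partial_sum (z 0) k oU C1 Uw).
rewrite (partial_open_eq l oU E1 Uy).
have CC k : Ck 1 U (fun w => \sum_j z 0 j * partial k (partial j f) w).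
  exact: (Ck_sum _ _ oU (fun j => CkM oU (Ck_cst 1 (z 0 j) oU) (C2 k j))).
rewrite (partial_sum (z 0) l oU CC Uy) mulr_sumr; apply: eq_bigr => k _.
rewrite (partial_sum (z 0) l oU (C2 k) Uy) !mulr_sumr; apply: eq_bigr => j _.
by rewrite !mulrA.
Qed.

Lemma is_derive_along k U z f y t : open U -> Ck k.+1 U f -> U (y + t *: z) ->
  is_derive t (1 : R) (fun s => f (y + s *: z)) (dirderiv z f (y + t *: z)).
Proof.
move=> oU Cf Uy; have [d1 d2] := Ck_is_derive_dir z oU Cf Uy.
rewrite /dirderiv -d2 [y + _]addrC.
have -> : (fun s => f (y + s *: z)) = (fun s => f (s *: z + y)).
  by apply/funext => s; rewrite addrC.
by apply: is_derive_line; rewrite addrC.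
Qed.
End LineDerivative.


(** * Landsberg and Douglas metrics *)

Section PlaneSpray.
Variables (R : realType) (n : nat).
Local Notation E := 'rV[R]_n.
Variables (e : R) (a : 'M[R]_n) (b X : E).
Variables (da : 'I_n -> 'M[R]_n) (db : 'I_n -> E).
Variables (F : E -> E -> R) (x : E).
Hypothesis e2 : e ^+ 2 = 1.
Hypothesis sa : a^T = a.
Hypothesis pa : forall y, y != 0 -> 0 < bform a y y.
Hypothesis aX : forall v, bform a X v = covec b v.
Hypothesis bX : covec b X = 1.
Hypothesis sda : forall k, (da k)^T = da k.
Hypothesis unitX : forall k, bform (da k) X X = 2 * covec (db k) X.
Hypothesis hF : forall y, F x y = exp_norm e a b y.
Hypothesis hdx : forall k y, 0 < covec b y ->
  dx k (Fsq F) x y = sqvar e a b y (bform (da k) y y) (covec (db k) y).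
Implicit Types (u v w y z : E) (t : R).

Lemma unitX_dir u : dform da u X X = 2 * dcovec db u X.
Proof.
by rewrite /dform /dcovec mulr_sumr; apply: eq_bigr => k _; rewrite unitX mulrCA.
Qed.

Lemma bform_eq0 v : (forall w, bform a w v = 0) -> v = 0.
Proof.
by move=> h; apply/eqP; apply/negPn/negP => /pa; rewrite h ltxx.
Qed.

Section Line.
Variable z : E.
Hypothesis bz : covec b z = 0.
Local Notation Z := (bform a z z).
Local Notation "'pt' t" := (X + t *: z) (at level 10).

Lemma covec_pt t : covec b (pt t) = 1.
Proof. by rewrite covecD covecZ bz mulr0 addr0. Qed.

Lemma bform_pt t v : bform a (pt t) v = covec b v + t * bform a z v.
Proof. by rewrite bformDl bformZl aX. Qed.

Lemma bform_ptX t : bform a (pt t) X = 1.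
Proof. by rewrite bform_pt bX (bform_sym z X sa) aX bz mulr0 addr0. Qed.

Lemma bform_ptpt t : bform a (pt t) (pt t) = 1 + t ^+ 2 * Z.
Proof.
by rewrite bform_pt covec_pt bformDr bformZr (bform_sym z X sa) aX bz; ring.
Qed.

Lemma hessian_X t v : hessian e a b (pt t) X v =
  gauge e a b (pt t) ^+ 2 * hessX e t Z (covec b v) (bform a z v).
Proof.
rewrite /hessian /sqvar2 /hessX covec_pt bform_ptpt bform_ptX bform_pt bX aX.
by field.
Qed.

Lemma hessian_z t v : hessian e a b (pt t) z v =
  gauge e a b (pt t) ^+ 2 * hessz e t Z (covec b v) (bform a z v).
Proof.
rewrite /hessian /sqvar2 /hessz covec_pt bform_ptpt !bform_pt bz.
by field.
Qed.

Local Notation Den t := (1 + 2 * e * t ^+ 2 * Z).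

(** A vector of the kernel has $P = Q = 0$ by [plane_kernel]; on such vectors the
    Hessian is a multiple of the metric. *)
Lemma regular_pt t : Den t != 0 -> fundamental_tensor F x (pt t) \in unitmx.
Proof.
move=> D0; apply: (regular_of_nondegenerate (e := e) (a := a) (b := b)) => //.
  by rewrite covec_pt.
move=> v hv.
have g0 : gauge e a b (pt t) ^+ 2 != 0 by rewrite expf_neq0// gt_eqF// gauge_gt0.
have [||P0 Q0] := plane_kernel (P := covec b v) (Q := bform a z v) e2 D0.
- by have := hv X; rewrite hessian_X => /eqP; rewrite mulf_eq0 (negPf g0) => /eqP.
- by have := hv z; rewrite hessian_z => /eqP; rewrite mulf_eq0 (negPf g0) => /eqP.
apply: bform_eq0 => w.
have e0 : e != 0 by rewrite -sqrf_eq0 e2 oner_eq0.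
apply: (mulfI (mulf_neq0 g0 (mulf_neq0 (_ : 4 != 0) e0))); first by rewrite pnatr_eq0.
rewrite mulr0 -(hv w) /hessian /sqvar2 (bform_pt t v) P0 Q0; ring.
Qed.

Let t2 := dform da X X z.
Let t3 := dform da X z z.
Let t5 := dform da z X z.
Let t6 := dform da z z z.
Let s1 := dcovec db X X.
Let s2 := dcovec db X z.
Let s3 := dcovec db z X.
Let s4 := dcovec db z z.
Local Notation N t := (t ^+ 2 * rho t3 t5 s4 + (2 * t ^+ 2 * Z - e) * t * sig s2 s3).

Lemma spray_pt t : Den t != 0 ->
  2 * covec b (spray_vec F x (pt t)) =
    s1 + t * s2 + t * s3 + t ^+ 2 * s4 - 2 * e * N t / Den t /\
  2 * bform a z (spray_vec F x (pt t)) =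
    t2 - 2 * s3 / 2 + t * t3 + t ^+ 2 / 2 * t6 + (2 + 2 * t ^+ 2 * Z - e) * sig s2 s3
      - 4 * e * t * Z * N t / Den t.
Proof.
move=> D0.
have g0 : gauge e a b (pt t) ^+ 2 != 0 by rewrite expf_neq0// gt_eqF// gauge_gt0.
have b0 : 0 < covec b (pt t) by rewrite covec_pt.
have h w := hessian_spray sa sda hF hdx w b0 (regular_pt D0).
have symT u : dform da u z X = dform da u X z by apply: dform_sym.
have PS := @plane_solution R e t Z (covec b (2 *: spray_vec F x (pt t)))
  (bform a z (2 *: spray_vec F x (pt t))) t2 t3 t5 t6 s1 s2 s3 s4 e2 D0.
rewrite -covecZ -(bformZr a 2 z); cbv zeta in PS; apply: PS.
- apply: (mulfI g0); rewrite -hessian_X h /euler /sqvar2 /sqvar covec_pt bform_ptpt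
    bform_ptX bX.
  rewrite !(dformDl, dformZl, dformDm, dformZm, dformDr, dformZr, dcovecDl, dcovecZl,
    dcovecDr, dcovecZr) !symT !unitX_dir -/t2 -/t3 -/t5 -/t6 -/s1 -/s2 -/s3 -/s4.
  by field.
- apply: (mulfI g0); rewrite -hessian_z h /euler /sqvar2 /sqvar covec_pt bform_ptpt
    bform_pt bz.
  rewrite !(dformDl, dformZl, dformDm, dformZm, dformDr, dformZr, dcovecDl, dcovecZl,
    dcovecDr, dcovecZr) !symT !unitX_dir -/t2 -/t3 -/t5 -/t6 -/s1 -/s2 -/s3 -/s4.
  by field.
Qed.
End Line.

(** This is $2(\nabla\beta)(v,v) = (L_XA)(v,v)$, written without Christoffel symbols. *)
Definition killing v : R := dform da X v v + 2 * dcovec db v v - 2 * dform da v X v.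

(** Both [rho] and [sig] are homogeneous in [z], so short vectors suffice; the
    component of [v] along $X$ contributes nothing because $|\beta| = 1$. *)
Lemma killing_of_small :
  (forall z, covec b z = 0 -> 0 < bform a z z -> bform a z z < 1 / 2 ->
     rho (dform da X z z) (dform da z X z) (dcovec db z z) = 0 /\
     sig (dcovec db X z) (dcovec db z X) = 0) ->
  forall v, killing v = 0.
Proof.
move=> small v.
have [z [bz vE]] : exists z, covec b z = 0 /\ v = covec b v *: X + z.
  exists (v - covec b v *: X); split; last by rewrite addrC subrK.
  by rewrite covecD -scaleNr covecZ bX mulr1 subrr.
have symT u : dform da u z X = dform da u X z by apply: dform_sym.
have [r0 s0] : rho (dform da X z z) (dform da z X z) (dcovec db z z) = 0 /\
     sig (dcovec db X z) (dcovec db z X) = 0.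
  have [->|z0] := eqVneq z 0.
    have d0 u w : dform da u 0 w = 0 by rewrite -(scale0r 0) dformZm mul0r.
    have d1 u w : dform da u w 0 = 0 by rewrite -(scale0r 0) dformZr mul0r.
    have c0 u : dcovec db u 0 = 0 by rewrite -(scale0r 0) dcovecZr mul0r.
    have c1 u : dcovec db 0 u = 0 by rewrite -(scale0r 0) dcovecZl mul0r.
    by rewrite /rho /sig !(d0,d1,c0,c1); split; field.
  have Z0 := pa z0; set Z := bform a z z in Z0.
  have k0 : 0 < 1 + 2 * Z by lra.
  pose k := (1 + 2 * Z)^-1; have kp : 0 < k by rewrite invr_gt0.
  have kE : k * (1 + 2 * Z) = 1 by rewrite mulVf// gt_eqF.
  have [|||] := small (k *: z); rewrite ?bformZl ?bformZr -/Z.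
  - by rewrite covecZ bz mulr0.
  - by rewrite !mulr_gt0.
  - have kZ : k * Z < 1 / 2 by lra.
    have k1 : k < 1 by have := mulr_gt0 kp Z0; lra.
    by rewrite (lt_trans _ kZ)// gtr_pMl// mulr_gt0.
  rewrite !(dformZl, dformZm, dformZr, dcovecZl, dcovecZr) => r1 s1; split.
    have k20 : k ^+ 2 != 0 by rewrite expf_neq0// gt_eqF.
    by apply: (mulfI k20); rewrite mulr0 -r1 /rho; field.
  have kn0 : k != 0 by rewrite gt_eqF.
  by apply: (mulfI kn0); rewrite mulr0 -s1 /sig; field.
rewrite vE /killing; set c := covec b v.
rewrite !(dformDl, dformZl, dformDm, dformZm, dformDr, dformZr, dcovecDl, dcovecZl,
    dcovecDr, dcovecZr) !symT !unitX_dir.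
transitivity (2 * 0 - 4 * c * 0 : R); last by ring.
by rewrite -{1}r0 -s0 /rho /sig; field.
Qed.
Let Ub : set E := [set y | 0 < covec b y].
Let oUb : open Ub. Proof. exact: open_covec_gt0. Qed.

Lemma Ck_covec k (c : E) : Ck k Ub (covec c).
Proof. by apply: Ck_sum => // i; apply: CkM => //; [exact: Ck_cst|exact: Ck_coord]. Qed.

Lemma Ck_bform k (c : 'M[R]_n) : Ck k Ub (fun y => bform c y y).
Proof.
apply: Ck_sum => // i; apply: Ck_sum => // j; apply: CkM => //; last exact: Ck_coord.
by apply: CkM => //; [exact: Ck_cst|exact: Ck_coord].
Qed.

Lemma Ck_ratio k : Ck k Ub (fun y => bform a y y / covec b y ^+ 2).
Proof.
apply: CkM => //; first exact: Ck_bform.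
apply: CkV => //; first by move=> y y0; rewrite expf_neq0// gt_eqF.
by apply: CkM => //; exact: Ck_covec.
Qed.

Lemma Ck_gauge k : Ck k Ub (gauge e a b).
Proof. by apply: Ck_expR => //; apply: CkM => //; [exact: Ck_cst|exact: Ck_ratio]. Qed.

Lemma Ck_Fsq k : Ck k Ub (Fsq F x).
Proof.
apply: (Ck_ext (f := fun y => (covec b y * gauge e a b y) * (covec b y * gauge e a b y))) => //.
  by move=> y _; rewrite /Fsq hF.
by apply: CkM => //; apply: CkM => //; first [exact: Ck_covec|exact: Ck_gauge].
Qed.

Lemma Ck_dxFsq i k : Ck k Ub (dx i (Fsq F) x).
Proof.
apply: (Ck_ext (f := fun y => (gauge e a b y * gauge e a b y) *
   (2 * e * bform (da i) y y + (2 - 4 * e * (bform a y y / covec b y ^+ 2)) *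
     covec b y * covec (db i) y))) => //.
  by move=> y y0; rewrite hdx.
apply: CkM => //; first by apply: CkM => //; exact: Ck_gauge.
apply: CkD => //; first by apply: CkM => //; [exact: Ck_cst|exact: Ck_bform].
apply: CkM => //; last exact: Ck_covec.
apply: CkM => //; last exact: Ck_covec.
apply: CkB => //; first exact: Ck_cst.
by apply: CkM => //; [exact: Ck_cst|exact: Ck_ratio].
Qed.

Lemma Ck_fundamental k i j : Ck k Ub (fun y => fundamental_tensor F x y i j).
Proof.
apply: (Ck_ext (f := fun y => 2^-1 * partial j (partial i (Fsq F x)) y)) => //.
  by move=> y _; rewrite mxE.
apply: CkM => //; first exact: Ck_cst.
by apply: Ck_partial; apply: Ck_partial; exact: Ck_Fsq.
Qed.

Definition regular : set E := Ub `&` [set y | fundamental_tensor F x y \in unitmx].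

Lemma open_regular : open regular.
Proof.
rewrite openE => y [y0 uy]; rewrite /interior.
have cdet : {for y, continuous (fun y => \det (fundamental_tensor F x y))}.
  by apply: (Ck_cont (Ck_det oUb (Ck_fundamental 0)) y0).
have nz : \forall w \near y, \det (fundamental_tensor F x w) != 0.
  have d0 : \det (fundamental_tensor F x y) != 0 by move: uy; rewrite /= unitmxE unitfE.
  have nn : nbhs (\det (fundamental_tensor F x y)) [set r : R | r != 0].
    by apply: open_nbhs_nbhs; split=> //; exact: open_neq.
  exact: cdet nn.
near=> w; split; first by near: w; exact: open_nbhs_nbhs.
by rewrite /= unitmxE unitfE; near: w.
Unshelve. all: by end_near. Qed.

Lemma Ck_spray k i : Ck k regular (spray_coef F i x).
Proof.
have oR := open_regular.
have RU : regular `<=` Ub by move=> y [].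
apply: CkM => //; first exact: Ck_cst.
apply: Ck_sum => // l; apply: CkM => //.
  apply: Ck_invmx => //; first by move=> y [].
  by move=> i' j'; apply: (Ck_subset RU); exact: Ck_fundamental.
apply: CkB => //; last by apply: (Ck_subset RU); exact: Ck_dxFsq.
apply: Ck_sum => // m; apply: CkM => //; last exact: Ck_coord.
by apply: (Ck_subset RU); apply: (Ck_partial l); exact: Ck_dxFsq.
Qed.

Lemma F_gt0 y : 0 < covec b y -> 0 < F x y.
Proof. by move=> y0; rewrite hF mulr_gt0// gauge_gt0. Qed.

Lemma dyF y i : 0 < covec b y -> dy i F x y = gauge e a b y *
  (b 0 i + e * (2 * bform a y (delta_mx 0 i) / covec b y
                - 2 * bform a y y * b 0 i / covec b y ^+ 2)).
Proof.
move=> y0; have yn0 : covec b y != 0 by rewrite gt_eqF.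
have FE : F x = (fun w => covec b w * gauge e a b w) by apply/funext => w; rewrite hF.
rewrite /dy /partial FE.
have [_ ->] := is_derive_exp_metric e yn0 (is_derive_bform y (delta_mx 0 i) sa)
  (is_derive_covec b y (delta_mx 0 i)).
by rewrite covec_delta.
Qed.

Section SmallVector.
Variable z : E.
Hypothesis bz : covec b z = 0.
Hypothesis Z0 : 0 < bform a z z.
Hypothesis Z1 : bform a z z < 1 / 2.
Local Notation Z := (bform a z z).

(** Short vectors avoid the hypersurface where the fundamental tensor degenerates
    when $\epsilon = -1$. *)
Lemma den_small t : 0 <= t <= 1 -> 1 + 2 * e * t ^+ 2 * Z != 0.
Proof.
move=> /andP[t0 t1]; have t2 : t ^+ 2 <= 1 by rewrite expr_le1.
have tZ : t ^+ 2 * Z < 1 / 2 by rewrite (le_lt_trans _ Z1)// ler_piMl// ltW.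
have tZ0 : 0 <= t ^+ 2 * Z by rewrite mulr_ge0 ?sqr_ge0// ltW.
move/eqP: e2; rewrite sqrf_eq1 => /orP[] /eqP ->; apply/eqP; nra.
Qed.

Local Notation t2 := (dform da X X z).
Local Notation t3 := (dform da X z z).
Local Notation t5 := (dform da z X z).
Local Notation t6 := (dform da z z z).
Local Notation s1 := (dcovec db X X).
Local Notation s2 := (dcovec db X z).
Local Notation s3 := (dcovec db z X).
Local Notation s4 := (dcovec db z z).

(** Contracted with [z] in its three indices, the Landsberg curvature at $X + z$ is
    the third derivative, along the line in the direction [z], of the spray paired
    with the constant covector $F_y(X + z)$. *)
Lemma landsberg_relation :
  (forall y, 0 < F x y -> fundamental_tensor F x y \in unitmx ->
    forall j k l, landsberg_curvature F j k l x y = 0) ->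
  rho t3 t5 s4 + (2 * Z - e) * sig s2 s3 = 0.
Proof.
move=> hL.
pose y1 := X + 1 *: z.
have by1 : covec b y1 = 1 by rewrite (covec_pt bz).
have A1 : bform a y1 y1 = 1 + Z by rewrite (bform_ptpt bz) expr1n mul1r.
pose c i := 2 * (b 0 i + e * (2 * bform a y1 (delta_mx 0 i) - 2 * (1 + Z) * b 0 i)).
pose phi w := \sum_i c i * spray_coef F i x w.
pose V : set R := [set t | quartic 1 0 (2 * e * Z) 0 0 t != 0].
have qE t : quartic 1 0 (2 * e * Z) 0 0 t = 1 + 2 * e * t ^+ 2 * Z by rewrite /quartic; ring.
have oV : open V.
  apply: (@open_comp _ _ (quartic 1 0 (2 * e * Z) 0 0) [set r | r != 0]); last exact: open_neq.
  move=> t _; have [/derivable1_diffP /differentiable_continuous + _] :=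
    is_derive_quartic 1 0 (2 * e * Z) 0 0 t.
  exact.
have VR t : V t -> regular (X + t *: z).
  move=> Vt; split; first by rewrite /Ub /= covec_pt.
  have Dt : 1 + 2 * e * t ^+ 2 * Z != 0 by move: Vt; rewrite /V /= qE.
  exact: (regular_pt bz Dt).
have V1 : V 1 by rewrite /V /= qE den_small// ler01 lexx.
have oR := open_regular.
have Cs i : Ck 4 regular (spray_coef F i x) := Ck_spray 4 i.
have Cphi : Ck 4 regular phi.
  exact: (Ck_sum _ _ oR (fun i => CkM oR (Ck_cst 4 (c i) oR) (Cs i))).
have C1 := Ck_dirderiv z oR Cphi; have C2 := Ck_dirderiv z oR C1.
apply: (@landsberg_line R e Z s1 s2 s3 s4 t2 t3 t5 t6 V
  (fun t => phi (X + t *: z)) (fun t => dirderiv z phi (X + t *: z))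
  (fun t => dirderiv z (dirderiv z phi) (X + t *: z))
  (fun t => dirderiv z (dirderiv z (dirderiv z phi)) (X + t *: z))) => //.
- by have := den_small (t := 1); rewrite expr1n mulr1; apply; rewrite ler01 lexx.
- by move=> t /VR Rt; exact: is_derive_along Cphi Rt.
- by move=> t /VR Rt; exact: is_derive_along C1 Rt.
- by move=> t /VR Rt; exact: is_derive_along C2 Rt.
- by move=> t; rewrite /V /= qE.
- move=> t; rewrite /V /= qE => Dt.
  have [<- <-] := spray_pt bz Dt.
  set G := spray_vec F x _.
  have -> : phi (X + t *: z) = 2 * ((1 - 2 * e * (1 + Z)) * covec b G + 2 * e * bform a y1 G).
    rewrite (linear_expand (L := bform a y1)); [|by move=> ? ?; exact: bformDr|by move=> ? ?; exact: bformZr].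
    rewrite /phi /covec !mulr_sumr -big_split mulr_sumr; apply: eq_bigr => i _ /=.
    by rewrite /c !mxE; ring.
  by rewrite /y1 bform_pt; ring.
have C3 i := CkS (Cs i).
have R1 := VR 1 V1.
rewrite (dirderiv3_sum z c oR C3 R1).
under eq_bigr => i _ do rewrite (dirderiv3E z oR (C3 i) R1) mulr_sumr.
rewrite exchange_big big1// => l _.
under eq_bigr => i _ do rewrite mulr_sumr.
rewrite exchange_big big1// => k _.
under eq_bigr => i _ do rewrite mulr_sumr.
rewrite exchange_big big1// => j _.
have F1 : 0 < F x (X + 1 *: z) by apply: F_gt0; rewrite by1.
have := hL _ F1 R1.2 j k l; rewrite /landsberg_curvature => /eqP.
have Fn : - 2^-1 * F x (X + 1 *: z) != 0.
  by rewrite mulf_neq0// ?oppr_eq0 ?invr_eq0 ?pnatr_eq0// gt_eqF.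
rewrite mulf_eq0 (negPf Fn) /= => /eqP L0.
have g0 : gauge e a b y1 != 0 by rewrite gt_eqF// gauge_gt0.
apply: (mulfI g0); rewrite mulr0.
transitivity (2 * z 0 l * z 0 k * z 0 j * 0); last by rewrite mulr0.
rewrite -[X in _ = _ * X]L0 !mulr_sumr; apply: eq_bigr => i _.
rewrite dyF by1 ?ltr01// A1 /c /dy.
by field.
Qed.

(** Paired with $\beta$ and $\langle z,\cdot\rangle$, the Douglas tensor
    $G^iy^j - G^jy^i$ contains $tN(t)/D(t)$, which can be a cubic in $t$ only
    if it vanishes. *)
Lemma douglas_relation :
  (forall j k, exists2 q, homogeneous_cubic q &
    forall y, 0 < F x y -> fundamental_tensor F x y \in unitmx ->
      spray_coef F j x y * y 0 k - spray_coef F k x y * y 0 j = q y) ->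
  rho t3 t5 s4 = 0 /\ sig s2 s3 = 0.
Proof.
move=> hD; pose w := z *m a.
have : cubic_on_unit (fun t => \sum_j \sum_k b 0 j * w 0 k *
  (spray_coef F j x (X + t *: z) * (X + t *: z) 0 k
   - spray_coef F k x (X + t *: z) * (X + t *: z) 0 j)).
  apply: cubic_sum => j; apply: cubic_sum => k; apply: cubic_scale.
  have [q cq qE] := hD j k; have [c0 [c1 [c2 [c3 h]]]] := cubic_line X z cq.
  exists c0, c1, c2, c3 => t tI; rewrite -h// qE//.
    by apply: F_gt0; rewrite (covec_pt bz).
  exact: (regular_pt bz (den_small tI)).
case=> c0 [c1 [c2 [c3 h]]].
set r := rho _ _ _; set si := sig _ _.
pose q0 := t2 - s3 + (2 - e) * si; pose q2 := t6 / 2 + 2 * Z * si.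
pose d0 := 2 * c0 + q0.
pose d1 := 2 * c1 + t3 - Z * s1.
pose d2 := 2 * c2 + q2 - Z * (s2 + s3).
pose d3 := 2 * c3 - Z * s4.
have H t : 0 <= t <= 1 ->
   d0 + d1 * t + (d2 + 2 * e * Z * d0 + 2 * Z * si) * t ^+ 2
   + (d3 + 2 * e * Z * d1 - 2 * e * Z * r) * t ^+ 3
   + (2 * e * Z * d2 - 4 * e * Z ^+ 2 * si) * t ^+ 4 + (2 * e * Z * d3) * t ^+ 5 = 0.
  move=> tI; have Dt := den_small tI.
  have [PE QE] := spray_pt bz Dt.
  have LE : \sum_j \sum_k b 0 j * w 0 k *
     (spray_coef F j x (X + t *: z) * (X + t *: z) 0 k
      - spray_coef F k x (X + t *: z) * (X + t *: z) 0 j) =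
     covec b (spray_vec F x (X + t *: z)) * (t * Z) - bform a z (spray_vec F x (X + t *: z)).
    set G := spray_vec _ _ _; set y := X + t *: z.
    have -> : t * Z = covec w y.
      by rewrite -bformE (bform_sym z y sa) bform_pt bz add0r.
    have -> : bform a z G = covec b y * covec w G by rewrite (covec_pt bz) mul1r -bformE.
    rewrite /covec !big_distrlr /= -sumrB; apply: eq_bigr => j _.
    by rewrite -sumrB; apply: eq_bigr => k _; rewrite !mxE; ring.
  have := h t tI; rewrite LE => hh.
  have : (2 * covec b (spray_vec F x (X + t *: z))) * (t * Z)
     - 2 * bform a z (spray_vec F x (X + t *: z))
     - 2 * (c0 + c1 * t + c2 * t ^+ 2 + c3 * t ^+ 3) = 0 by rewrite -hh; ring.
  rewrite PE QE => {}hh.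
  have <- : - (1 + 2 * e * t ^+ 2 * Z) * 0 = 0 by rewrite mulr0.
  rewrite -{1}hh /d0 /d1 /d2 /d3 /q0 /q2 -/r -/si.
  have /eqP := e2; rewrite sqrf_eq1 => /orP[] /eqP E1; rewrite !E1 in Dt *; field;
  move: Dt; congr (~~ (_ == _)); ring.
have [[E0 E1 E2] [E3 E4 E5]] := quintic_eq0 H.
have e0 : e != 0 by rewrite -sqrf_eq0 e2 oner_eq0.
have eZ : 2 * e * Z != 0 by rewrite !mulf_neq0// ?pnatr_eq0// gt_eqF.
rewrite E0 E1 in E2 E3.
have d30 : d3 = 0 by apply: (mulfI eZ); rewrite mulr0.
have d2E : d2 = - 2 * Z * si by lra.
split.
  by apply: (mulfI eZ); rewrite mulr0; rewrite d30 in E3; lra.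
have eZ2 : 8 * e * Z ^+ 2 != 0 by rewrite !mulf_neq0// ?pnatr_eq0 ?expf_neq0// gt_eqF.
by apply: (mulfI eZ2); rewrite mulr0; rewrite d2E in E4; rewrite -[RHS]oppr0 -E4; ring.
Qed.
End SmallVector.
End PlaneSpray.

(** * Conformal fields and a Killing dual field *)

Section MatrixFields.
Variables (R : realType) (n : nat).
Local Notation E := 'rV[R]_n.
Implicit Types (U : set E) (A : E -> 'M[R]_n) (B V W : E -> E) (x u v w : E).

Definition Ck_matrix_field k U A := forall i j, Ck k U (fun x => A x i j).
Definition Ck_row_field k U V := forall j, Ck k U (fun x => V x 0 j).

Definition dmat u A x : 'M[R]_n := \matrix_(i, j) dirderiv u (fun z => A z i j) x.
Definition drow u V x : E := \row_j dirderiv u (fun z => V z 0 j) x.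
Definition d2mat u w A x : 'M[R]_n :=
  \matrix_(i, j) dirderiv u (dirderiv w (fun z => A z i j)) x.
Definition d2row u w V x : E := \row_j dirderiv u (dirderiv w (fun z => V z 0 j)) x.

Lemma dirderivDl u w f x : dirderiv (u + w) f x = dirderiv u f x + dirderiv w f x :> R.
Proof. by rewrite -big_split; apply: eq_bigr => j _; rewrite mxE mulrDl. Qed.
Lemma dirderivZl c u f x : dirderiv (c *: u) f x = c * dirderiv u f x :> R.
Proof. by rewrite mulr_sumr; apply: eq_bigr => j _; rewrite mxE mulrA. Qed.

Lemma dmatD u w A x : dmat (u + w) A x = dmat u A x + dmat w A x.
Proof. by apply/matrixP => i j; rewrite !mxE dirderivDl. Qed.
Lemma dmatZ c u A x : dmat (c *: u) A x = c *: dmat u A x.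
Proof. by apply/matrixP => i j; rewrite !mxE dirderivZl. Qed.

Lemma bform_matD (a a' : 'M[R]_n) v w : bform (a + a') v w = bform a v w + bform a' v w.
Proof. by rewrite !bformE mulmxDr covecC covecD -!(covecC _ w). Qed.
Lemma bform_matZ c (a : 'M[R]_n) v w : bform (c *: a) v w = c * bform a v w.
Proof. by rewrite !bformE -scalemxAr covecC covecZ covecC. Qed.

Lemma dirderiv_comm U f x u w : open U -> Ck 2 U f -> U x ->
  dirderiv u (dirderiv w f) x = dirderiv w (dirderiv u f) x.
Proof.
move=> oU Cf Ux; have C1 j := Ck_partial j Cf.
have E1 (u' w' : E) : dirderiv u' (dirderiv w' f) x =
    \sum_k \sum_j u' 0 k * w' 0 j * partial k (partial j f) x.
  apply: eq_bigr => k _; rewrite /dirderiv (partial_sum (w' 0) k oU C1 Ux) mulr_sumr.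
  by apply: eq_bigr => j _; rewrite mulrA.
rewrite !E1 exchange_big; apply: eq_bigr => j _; apply: eq_bigr => k _.
by rewrite (partial_comm k j oU Cf Ux) [u 0 k * _]mulrC.
Qed.

Lemma d2mat_comm U A x u w : open U -> Ck_matrix_field 2 U A -> U x ->
  d2mat u w A x = d2mat w u A x.
Proof.
by move=> oU CA Ux; apply/matrixP => i j; rewrite !mxE; exact: (dirderiv_comm u w oU (CA i j)).
Qed.

Lemma d2row_comm U V x u w : open U -> Ck_row_field 2 U V -> U x ->
  d2row u w V x = d2row w u V x.
Proof.
by move=> oU CV Ux; apply/rowP => j; rewrite !mxE; exact: (dirderiv_comm u w oU (CV j)).
Qed.

(** Recorded as facts about derivability, so that products of fields are
    differentiated by Leibniz' rule componentwise. *)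
Definition is_drow u V x (V' : E) := forall j, is_derive x u (fun z => V z 0 j) (V' 0 j).
Definition is_dmat u A x (A' : 'M[R]_n) :=
  forall i j, is_derive x u (fun z => A z i j) (A' i j).

Lemma is_drowP k U V x u : open U -> Ck_row_field k.+1 U V -> U x -> is_drow u V x (drow u V x).
Proof. by move=> oU CV Ux j; rewrite mxE; exact: (Ck_is_derive_dir u oU (CV j) Ux). Qed.

Lemma is_dmatP k U A x u : open U -> Ck_matrix_field k.+1 U A -> U x -> is_dmat u A x (dmat u A x).
Proof. by move=> oU CA Ux i j; rewrite mxE; exact: (Ck_is_derive_dir u oU (CA i j) Ux). Qed.

Lemma is_drow_cst u v x : is_drow u (fun=> v) x 0.
Proof. by move=> j; rewrite mxE; exact: is_derive_cst. Qed.

Lemma is_derive_mul (f g : E -> R) x u (df dg : R) : is_derive x u f df -> is_derive x u g dg ->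
  is_derive x u (fun z => f z * g z) (df * g x + f x * dg).
Proof.
move=> hf hg; apply: is_derive_eq (is_deriveM hf hg) _.
by rewrite /GRing.scale /= addrC [g x * _]mulrC.
Qed.

Lemma is_derive_add (f g : E -> R) x u (df dg : R) : is_derive x u f df -> is_derive x u g dg ->
  is_derive x u (fun z => f z + g z) (df + dg).
Proof. by move=> hf hg; exact: is_deriveD. Qed.

Lemma is_derive_covec_field u V W x (V' W' : E) : is_drow u V x V' -> is_drow u W x W' ->
  is_derive x u (fun z => covec (V z) (W z)) (covec V' (W x) + covec (V x) W').
Proof.
move=> hV hW; rewrite /covec -big_split; apply: is_derive_bigsum => k.
exact: is_derive_mul.
Qed.

Lemma is_derive_bform_field u A V W x (A' : 'M[R]_n) (V' W' : E) :
  is_dmat u A x A' -> is_drow u V x V' -> is_drow u W x W' ->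
  is_derive x u (fun z => bform (A z) (V z) (W z))
    (bform A' (V x) (W x) + bform (A x) V' (W x) + bform (A x) (V x) W').
Proof.
move=> hA hV hW; rewrite /bform -!big_split; apply: is_derive_bigsum => k.
rewrite -!big_split; apply: is_derive_bigsum => l /=; rewrite -mulrDl.
apply: is_derive_mul => //; exact: is_derive_mul.
Qed.

Lemma is_derive_dirderiv U f V x u (V' : E) : open U -> Ck 2 U f -> U x -> is_drow u V x V' ->
  is_derive x u (fun z => dirderiv (V z) f z)
    (dirderiv V' f x + dirderiv u (dirderiv (V x) f) x).
Proof.
move=> oU Cf Ux hV; have C1 j := Ck_partial j Cf.
have -> : dirderiv u (dirderiv (V x) f) x = \sum_j V x 0 j * dirderiv u (partial j f) x.
  exact: (dirderiv_sum u (V x 0) oU C1 Ux).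
rewrite /dirderiv -big_split; apply: is_derive_bigsum => k /=.
by apply: is_derive_mul => //; exact: (Ck_is_derive_dir u oU (C1 k) Ux).
Qed.

Lemma is_dmat_dmat U A V x u (V' : E) : open U -> Ck_matrix_field 2 U A -> U x -> is_drow u V x V' ->
  is_dmat u (fun z => dmat (V z) A z) x (dmat V' A x + d2mat u (V x) A x).
Proof.
move=> oU CA Ux hV i j; rewrite !mxE.
have := is_derive_dirderiv oU (CA i j) Ux hV.
by congr (is_derive _ _ _ _); apply/funext => z; rewrite mxE.
Qed.

Lemma is_drow_drow U W V x u (V' : E) : open U -> Ck_row_field 2 U W -> U x -> is_drow u V x V' ->
  is_drow u (fun z => drow (V z) W z) x (drow V' W x + d2row u (V x) W x).
Proof.
move=> oU CW Ux hV j; rewrite !mxE.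
have := is_derive_dirderiv oU (CW j) Ux hV.
by congr (is_derive _ _ _ _); apply/funext => z; rewrite mxE.
Qed.

Lemma drow0 V x : drow 0 V x = 0.
Proof.
by apply/rowP => j; rewrite !mxE; rewrite /dirderiv big1// => k _; rewrite mxE mul0r.
Qed.

Lemma derive_unique U (f g : E -> R) x u (df dg : R) : open U -> U x ->
  (forall z, U z -> f z = g z) -> is_derive x u f df -> is_derive x u g dg -> df = dg.
Proof.
by move=> oU Ux fg hf [_ <-]; have [_ <-] := is_derive_open oU Ux fg hf.
Qed.
End MatrixFields.

Section ConformalKilling.
Variables (R : realType) (n : nat).
Local Notation E := 'rV[R]_n.
Variables (U : set E) (A : E -> 'M[R]_n) (B X V : E -> E) (c : E -> R).
Hypothesis oU : open U.
Hypothesis CA : Ck_matrix_field 2 U A.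
Hypothesis CB : Ck_row_field 2 U B.
Hypothesis CX : Ck_row_field 2 U X.
Hypothesis CV : Ck_row_field 2 U V.
Hypothesis Cc : Ck 1 U c.
Hypothesis sA : forall x, U x -> (A x)^T = A x.
Hypothesis pA : forall x y, U x -> y != 0 -> 0 < bform (A x) y y.
Hypothesis AX : forall x v, U x -> bform (A x) (X x) v = covec (B x) v.
Hypothesis BX : forall x, U x -> covec (B x) (X x) = 1.
Hypothesis killingX : forall x v, U x ->
  bform (dmat (X x) A x) v v + 2 * covec (drow v B x) v - 2 * bform (dmat v A x) (X x) v = 0.
Hypothesis lieB : forall x w, U x ->
  covec (drow (V x) B x) w + covec (B x) (drow w V x) = 2 * c x * covec (B x) w.
Hypothesis lieA : forall x v w, U x ->
  bform (dmat (V x) A x) v w + bform (A x) (drow v V x) w + bform (A x) v (drow w V x)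
  = 4 * c x * bform (A x) v w.
Implicit Types (x u v w : E).

Lemma deriv_dual x u w : U x ->
  bform (dmat u A x) (X x) w + bform (A x) (drow u X x) w = covec (drow u B x) w.
Proof.
move=> Ux.
have h1 := is_derive_bform_field (is_dmatP u oU CA Ux) (is_drowP u oU CX Ux) (is_drow_cst u w x).
have h2 := is_derive_covec_field (is_drowP u oU CB Ux) (is_drow_cst u w x).
have := derive_unique oU Ux _ h1 h2; rewrite bform0r covec0 !addr0; apply => z Uz.
exact: AX.
Qed.

Lemma killingE x v : U x ->
  bform (dmat (X x) A x) v v + 2 * bform (A x) (drow v X x) v = 0.
Proof.
by move=> Ux; have := killingX v Ux; have := deriv_dual v v Ux; lra.
Qed.

Lemma dmat_sym u x : U x -> (dmat u A x)^T = dmat u A x.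
Proof.
move=> Ux; apply/matrixP => i j; rewrite !mxE; apply: (dirderiv_open_eq u oU _ Ux) => z Uz.
by have /matrixP/(_ i j) := sA Uz; rewrite mxE.
Qed.

Lemma killing_polar x v w : U x ->
  bform (dmat (X x) A x) v w + bform (A x) (drow v X x) w + bform (A x) (drow w X x) v = 0.
Proof.
move=> Ux; have := killingE (v + w) Ux; have := killingE v Ux; have := killingE w Ux.
have -> : drow (v + w) X x = drow v X x + drow w X x.
  by apply/rowP => j; rewrite !mxE dirderivDl.
rewrite !(bformDl, bformDr) (bform_sym w v (dmat_sym (X x) Ux)).
lra.
Qed.

(** The Lie derivative along [V] of the identity [AX], solved for $L_VX$. *)
Lemma bracket x : U x -> drow (X x) V x - drow (V x) X x = (2 * c x) *: X x.
Proof.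
move=> Ux; apply/eqP; rewrite -subr_eq0; apply/eqP.
set v := _ - _; apply/eqP; apply/negPn/negP => /(pA Ux).
have : bform (A x) v v = 0.
  have h w : bform (A x) v w = 0.
    rewrite /v -scaleNr !(bformDl, bformZl) -scaleN1r bformZl AX//.
    have := deriv_dual (V x) w Ux; have := lieB w Ux; have := lieA (X x) w Ux.
    by rewrite !AX//; lra.
  exact: h.
by move=> ->; rewrite ltxx.
Qed.

(** Elimination of the second derivatives of the metric and of [V], [X], and of the
    products of first derivatives. *)
Let linear_step (D1 D2 H M1 M2 L1 L2 a1 a2 S K Q N dX dv be k : R) :
  D1 + H + 2 * (M1 + L1) = 4 * (dX * N + k * K) ->
  D2 + H + 2 * (M2 + L2) = 0 ->
  a1 + L1 + -1 * (a2 + L2) = 2 * dv * be + 2 * k * Q ->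
  D1 + -1 * D2 = 2 * k * K ->
  M1 + a2 + S = 0 -> M2 + a1 + S = 4 * k * Q ->
  k * (K + 2 * Q) = 0 -> dv * be = dX * N.
Proof. lra. Qed.

(** The Lie equation of the metric along [V] is differentiated along [X], and the
    Killing equation along [V].  By symmetry of second derivatives the difference
    involves the bracket only, whose derivative brings in the gradient of [c]. *)
Lemma conformal_factor_relation x v : U x ->
  dirderiv v c x * covec (B x) v = dirderiv (X x) c x * bform (A x) v v.
Proof.
move=> Ux.
have hv u := is_drow_cst u v x.
have hA u := is_dmatP u oU CA Ux.
have hc u := Ck_is_derive_dir u oU Cc Ux.
have hX u := is_drowP u oU CX Ux.
have hV u := is_drowP u oU CV Ux.
(* the Lie equation of the metric, differentiated along X *)
have e1 : bform (dmat (drow (X x) V x) A x + d2mat (X x) (V x) A x) v v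
    + 2 * (bform (dmat (X x) A x) (drow v V x) v + bform (A x) (d2row (X x) v V x) v)
    = 4 * (dirderiv (X x) c x * bform (A x) v v + c x * bform (dmat (X x) A x) v v).
  have h1 := is_derive_bform_field (is_dmat_dmat oU CA Ux (hV (X x))) (hv (X x)) (hv (X x)).
  have h2 := is_derive_bform_field (hA (X x)) (is_drow_drow oU CV Ux (hv (X x))) (hv (X x)).
  have h3 := is_derive_bform_field (hA (X x)) (hv (X x)) (hv (X x)).
  have h4 := is_derive_mul (hc (X x)) h3.
  have h5 := is_derive_add h1 (is_derive_mul (is_derive_cst (2 : R) x (X x)) h2).
  have h6 := is_derive_mul (is_derive_cst (4 : R) x (X x)) h4.
  have := derive_unique oU Ux _ h5 h6; rewrite !bform0r !bform0l drow0 !mul0r !add0r !addr0.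
  apply => z Uz; have := lieA v v Uz; rewrite (bform_sym v (drow v V z) (sA Uz)) /cst /=.
  lra.
(* the Killing equation, differentiated along V *)
have e2 : bform (dmat (drow (V x) X x) A x + d2mat (V x) (X x) A x) v v
    + 2 * (bform (dmat (V x) A x) (drow v X x) v + bform (A x) (d2row (V x) v X x) v) = 0.
  have h1 := is_derive_bform_field (is_dmat_dmat oU CA Ux (hX (V x))) (hv (V x)) (hv (V x)).
  have h2 := is_derive_bform_field (hA (V x)) (is_drow_drow oU CX Ux (hv (V x))) (hv (V x)).
  have h5 := is_derive_add h1 (is_derive_mul (is_derive_cst (2 : R) x (V x)) h2).
  have := derive_unique oU Ux _ h5 (is_derive_cst (0 : R) x (V x)).
  rewrite !bform0r !bform0l drow0 !mul0r !add0r !addr0.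
  by apply => z Uz; exact: killingE.
(* the bracket relation, differentiated along v *)
have e3 : drow (drow v X x) V x + d2row v (X x) V x - (drow (drow v V x) X x + d2row v (V x) X x)
   = (2 * dirderiv v c x) *: X x + (2 * c x) *: drow v X x.
  set p := drow (drow v X x) V x + _; set q := drow (drow v V x) X x + _.
  apply/rowP => j.
  have h1 : is_derive x v (fun z => drow (X z) V z 0 j) (p 0 j).
    exact: (is_drow_drow oU CV Ux (hX v) j).
  have h2 : is_derive x v (fun z => drow (V z) X z 0 j) (q 0 j).
    exact: (is_drow_drow oU CX Ux (hV v) j).
  have h3 := is_derive_mul (is_derive_mul (is_derive_cst (2 : R) x v) (hc v)) (hX v j).
  have E1 : p 0 j - q 0 j = (0 * c x + 2 * dirderiv v c x) * X x 0 j
      + 2 * c x * drow v X x 0 j.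
    apply: (derive_unique oU Ux _ (is_deriveB h1 h2) h3) => z Uz.
    have := congr1 (fun w : E => w 0 j) (bracket Uz).
    by rewrite /= [in LHS]mxE [X in _ + X]mxE [in RHS]mxE.
  have -> : (p - q) 0 j = p 0 j - q 0 j by rewrite mxE [X in _ + X]mxE.
  rewrite E1 mul0r add0r [RHS]mxE; congr (_ + _); by rewrite [RHS]mxE.
have e4 := congr1 (fun w => bform (A x) w v) e3.
have e5 := congr1 (fun w => bform (dmat w A x) v v) (bracket Ux).
have e6 := killing_polar (drow v V x) v Ux.
have e7 := lieA (drow v X x) v Ux.
have e8 := killingE v Ux.
rewrite /= -scaleN1r dmatD !dmatZ !(bform_matD, bform_matZ) in e5.
rewrite /= -scaleN1r !(bformDl, bformZl) AX// in e4.
rewrite !bform_matD (d2mat_comm (V x) (X x) oU CA Ux) in e1 e2.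
rewrite (d2row_comm (X x) v oU CV Ux) in e1.
rewrite (d2row_comm (V x) v oU CX Ux) in e2.
have e8c : c x * (bform (dmat (X x) A x) v v + 2 * bform (A x) (drow v X x) v) = 0.
  by rewrite e8 mulr0.
exact: (linear_step e1 e2 e4 e5 e6 e7 e8c).
Qed.
End ConformalKilling.

(** * Norms with a unit form on an open set *)

Section ConformalEquation.
Variable R : realType.

(** The conformal equation at $y = tX + w$, cleared of denominators, is a cubic in
    [t]; its coefficients are read off from four values. *)
Lemma conformal_coefficients (e c bX bw aXX aXw aww W : R) : e ^+ 2 = 1 ->
  aXX = 2 * bX ->
  (forall t, 0 < t -> t ^+ 2 * (t * bX + bw)
     + e * ((t ^+ 2 * aXX + 2 * t * aXw + aww) * t
            - 2 * (t ^+ 2 + W) * (t * bX + bw)) = 2 * c * t ^+ 3) ->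
  [/\ bX = 2 * c, W * bw = 0, bw + 2 * e * (aXw - bw) = 0 & aww = 2 * W * bX].
Proof.
move=> e2 aE h.
have h1 := h 1 ltac:(lra); have h2 := h 2 ltac:(lra).
have h3 := h 3 ltac:(lra); have h4 := h 4 ltac:(lra).
move: h1 h2 h3 h4; rewrite aE => h1 h2 h3 h4.
move/eqP: e2; rewrite sqrf_eq1 => /orP[] /eqP e1; rewrite e1 in h1 h2 h3 h4 *; split; lra.
Qed.
End ConformalEquation.

Section UnitChart.
Variables (R : realType) (n : nat).
Local Notation E := 'rV[R]_n.
Variables (U : set E) (A : E -> 'M[R]_n) (B X V : E -> E) (e : R) (F : E -> E -> R).
Hypothesis oU : open U.
Hypothesis CA : Ck_matrix_field 2 U A.
Hypothesis CB : Ck_row_field 2 U B.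
Hypothesis CX : Ck_row_field 2 U X.
Hypothesis CV : Ck_row_field 2 U V.
Hypothesis sA : forall x, U x -> (A x)^T = A x.
Hypothesis pA : forall x y, U x -> y != 0 -> 0 < bform (A x) y y.
Hypothesis AX : forall x v, U x -> bform (A x) (X x) v = covec (B x) v.
Hypothesis BX : forall x, U x -> covec (B x) (X x) = 1.
Hypothesis e2 : e ^+ 2 = 1.
Hypothesis FE : forall x y, U x -> F x y = exp_norm e (A x) (B x) y.
Implicit Types (x y u v w z : E).

Definition partial_mx x k := dmat (delta_mx 0 k) A x.
Definition partial_row x k := drow (delta_mx 0 k) B x.

Lemma dform_partialE x u v w : dform (partial_mx x) u v w = bform (dmat u A x) v w.
Proof.
rewrite (linear_expand (L := fun u => bform (dmat u A x) v w)) => //.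
- by move=> u1 u2; rewrite dmatD bform_matD.
- by move=> c u1; rewrite dmatZ bform_matZ.
Qed.

Lemma dcovec_partialE x u v : dcovec (partial_row x) u v = covec (drow u B x) v.
Proof.
rewrite (linear_expand (L := fun u => covec (drow u B x) v)) => //.
- move=> u1 u2; rewrite !(covecC _ v) -covecD; congr (covec v _).
  by apply/rowP => j; rewrite !mxE dirderivDl.
- move=> c u1; rewrite !(covecC _ v) -covecZ; congr (covec v _).
  by apply/rowP => j; rewrite !mxE dirderivZl.
Qed.

Lemma is_derive_A x u y : U x ->
  is_derive x u (fun z => bform (A z) y y) (bform (dmat u A x) y y).
Proof.
move=> Ux.
have h := is_derive_bform_field (is_dmatP u oU CA Ux) (is_drow_cst u y x) (is_drow_cst u y x).
apply: is_derive_eq h _.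
by rewrite bform0r bform0l !addr0.
Qed.

Lemma is_derive_B x u y : U x ->
  is_derive x u (fun z => covec (B z) y) (covec (drow u B x) y).
Proof.
move=> Ux.
have h := is_derive_covec_field (is_drowP u oU CB Ux) (is_drow_cst u y x).
by apply: is_derive_eq h _; rewrite covec0 addr0.
Qed.

Lemma is_derive_F x u y : U x -> 0 < covec (B x) y ->
  is_derive x u (fun z => F z y) (gauge e (A x) (B x) y *
    (covec (drow u B x) y + e * (bform (dmat u A x) y y / covec (B x) y
       - 2 * bform (A x) y y * covec (drow u B x) y / covec (B x) y ^+ 2))).
Proof.
move=> Ux y0; have yn0 : covec (B x) y != 0 by rewrite gt_eqF.
apply: (is_derive_open (f := fun z => exp_norm e (A z) (B z) y) oU Ux).
  by move=> z Uz; rewrite FE.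
have hA := is_derive_A u y Ux; have hB := is_derive_B u y Ux.
exact: (@is_derive_exp_metric R n _ (fun z => covec (B z) y) x u e _ _ yn0 hA hB).
Qed.

Lemma dx_FsqE x k y : U x -> 0 < covec (B x) y ->
  dx k (Fsq F) x y = sqvar e (A x) (B x) y (bform (partial_mx x k) y y) (covec (partial_row x k) y).
Proof.
move=> Ux y0; have yn0 : covec (B x) y != 0 by rewrite gt_eqF.
have [_] := is_derive_sqr (is_derive_F (delta_mx 0 k) Ux y0).
rewrite /dx /partial /Fsq => ->.
by rewrite FE// /exp_norm /sqvar -/(partial_mx x k) -/(partial_row x k); field.
Qed.

Lemma unit_derivative x k : U x -> bform (partial_mx x k) (X x) (X x) = 2 * covec (partial_row x k) (X x).
Proof.
move=> Ux; have h1 := deriv_dual oU CA CB CX AX (delta_mx 0 k) (X x) Ux.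
have h2 := is_derive_covec_field (is_drowP (delta_mx 0 k) oU CB Ux) (is_drowP (delta_mx 0 k) oU CX Ux).
have := derive_unique oU Ux _ h2 (is_derive_cst (1 : R) x (delta_mx 0 k)).
rewrite -/(partial_mx x k) -/(partial_row x k) => h3; rewrite -/(partial_mx x k) -/(partial_row x k) in h1.
have {h3} h3 := h3 (fun z Uz => BX Uz).
by rewrite (bform_sym _ (X x) (sA Ux)) AX// in h1; lra.
Qed.

Lemma partial_mx_sym x k : U x -> (partial_mx x k)^T = partial_mx x k.
Proof. exact: (dmat_sym oU sA). Qed.

Lemma killing_of_curvature x :
  (forall z, covec (B x) z = 0 -> 0 < bform (A x) z z -> bform (A x) z z < 1 / 2 ->
     rho (dform (partial_mx x) (X x) z z) (dform (partial_mx x) z (X x) z) (dcovec (partial_row x) z z) = 0 /\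
     sig (dcovec (partial_row x) (X x) z) (dcovec (partial_row x) z (X x)) = 0) -> U x ->
  forall v, bform (dmat (X x) A x) v v + 2 * covec (drow v B x) v
            - 2 * bform (dmat v A x) (X x) v = 0.
Proof.
move=> h Ux v.
have := killing_of_small (fun y => pA Ux) (BX Ux) (fun k => partial_mx_sym k Ux)
  (fun k => unit_derivative k Ux) h v.
by rewrite /killing !dform_partialE dcovec_partialE.
Qed.

(** Since [sig] is odd in [z] and [rho] even, the relation for [z] and for $-z$
    separates them. *)
Lemma killing_of_landsberg x : U x ->
  (forall y, 0 < F x y -> fundamental_tensor F x y \in unitmx ->
    forall j k l, landsberg_curvature F j k l x y = 0) ->
  forall v, bform (dmat (X x) A x) v v + 2 * covec (drow v B x) v
            - 2 * bform (dmat v A x) (X x) v = 0.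
Proof.
move=> Ux hL; apply: killing_of_curvature => // z bz Z0 Z1.
have rel w := @landsberg_relation R n e (A x) (B x) (X x) (partial_mx x) (partial_row x) F x e2 (sA Ux)
  (fun y => pA Ux) (fun v => AX v Ux) (BX Ux) (fun k => partial_mx_sym k Ux)
  (fun k => unit_derivative k Ux) (fun y => FE y Ux) (fun k y => dx_FsqE k Ux) w.
have r1 := rel z bz Z0 Z1 hL.
have bz' : covec (B x) (-1 *: z) = 0 by rewrite covecZ bz mulr0.
have r2 := rel (-1 *: z) bz'.
have ZN : bform (A x) (-1 *: z) (-1 *: z) = bform (A x) z z.
  by rewrite bformZl bformZr; ring.
rewrite ZN in r2; have {}r2 := r2 Z0 Z1 hL.
rewrite !(dformZl, dformZm, dformZr, dcovecZl, dcovecZr) in r2.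
move: r1 r2; rewrite /rho /sig; set Z := bform _ _ _ in Z0 Z1 *.
set p := dform _ _ _ _; set q := dform _ _ _ _; set s := dcovec _ _ _.
set s3 := dcovec _ z (X x); set s2 := dcovec _ (X x) z => r1 r2.
have E1 : (2 * Z - e) * ((s3 - s2) / 2) = 0 by lra.
have Ze : 2 * Z - e != 0.
  by move/eqP: e2; rewrite sqrf_eq1 => /orP[] /eqP ->; apply/eqP; lra.
have E2 : (s3 - s2) / 2 = 0 by apply: (mulfI Ze); rewrite mulr0.
by split=> //; rewrite E2 mulr0 addr0 in r1.
Qed.

Lemma killing_of_douglas x : U x ->
  (forall j k, exists2 q, homogeneous_cubic q &
    forall y, 0 < F x y -> fundamental_tensor F x y \in unitmx ->
      spray_coef F j x y * y 0 k - spray_coef F k x y * y 0 j = q y) ->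
  forall v, bform (dmat (X x) A x) v v + 2 * covec (drow v B x) v
            - 2 * bform (dmat v A x) (X x) v = 0.
Proof.
move=> Ux hD; apply: killing_of_curvature => // z bz Z0 Z1.
exact: (@douglas_relation R n e (A x) (B x) (X x) (partial_mx x) (partial_row x) F x e2 (sA Ux)
  (fun y => pA Ux) (fun v => AX v Ux) (BX Ux) (fun k => partial_mx_sym k Ux)
  (fun k => unit_derivative k Ux) (fun y => FE y Ux) (fun k y => dx_FsqE k Ux)).
Qed.

Definition lie_cov x w := covec (drow (V x) B x) w + covec (B x) (drow w V x).
Definition lie_met x v w := bform (dmat (V x) A x) v w + bform (A x) (drow v V x) w
  + bform (A x) v (drow w V x).

Lemma complete_liftE x y : U x -> 0 < covec (B x) y ->
  complete_lift F (V) x y = gauge e (A x) (B x) y *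
    (lie_cov x y + e * (lie_met x y y / covec (B x) y
       - 2 * bform (A x) y y * lie_cov x y / covec (B x) y ^+ 2)).
Proof.
move=> Ux y0; rewrite /complete_lift.
pose L1 u := gauge e (A x) (B x) y *
    (dcovec (partial_row x) u y + e * (dform (partial_mx x) u y y / covec (B x) y
       - 2 * bform (A x) y y * dcovec (partial_row x) u y / covec (B x) y ^+ 2)).
pose L2 w := gauge e (A x) (B x) y *
    (covec (B x) w + e * (2 * bform (A x) y w / covec (B x) y
       - 2 * bform (A x) y y * covec (B x) w / covec (B x) y ^+ 2)).
have -> : \sum_i V x 0 i * dx i F x y = L1 (V x).
  rewrite (linear_expand (L := L1)); first last.
  - by move=> c u; rewrite /L1 dcovecZl dformZl; ring.
  - by move=> u u'; rewrite /L1 dcovecDl dformDl; ring.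
  apply: eq_bigr => i _; congr (_ * _).
  have [_] := is_derive_F (delta_mx 0 i) Ux y0; rewrite /dx /partial => ->.
  by rewrite /L1 dcovec_partialE dform_partialE.
have -> : \sum_i \sum_j y 0 i * partial i (fun z => V z 0 j) x * dy j F x y =
    L2 (drow y V x).
  rewrite exchange_big (linear_expand (L := L2)); first last.
  - by move=> c u; rewrite /L2 covecZ bformZr; ring.
  - by move=> u u'; rewrite /L2 covecD bformDr; ring.
  apply: eq_bigr => j _; rewrite -mulr_suml mxE; congr (_ * _).
  by rewrite (dyF (sA Ux) (fun y => FE y Ux) j y0) /L2 covec_delta.
rewrite /L1 /L2 dcovec_partialE dform_partialE.
rewrite /lie_cov /lie_met (bform_sym (drow y V x) y (sA Ux)); ring.
Qed.

(** Comparing coefficients in the conformal equation, multiplied by $\beta^3$: the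
    constant one shows that $L_V\beta$ is proportional to $\beta$, the others
    determine $L_VA$ in terms of $L_V\beta$, and [lXX], the Lie derivative of
    $|\beta| = 1$, fixes the factor. *)
Lemma lie_equations x (k : R) : U x ->
  (forall y, 0 < F x y -> complete_lift F V x y = 2 * k * F x y) ->
  (forall w, lie_cov x w = 2 * k * covec (B x) w) /\
  (forall v w, lie_met x v w = 4 * k * bform (A x) v w).
Proof.
move=> Ux hc.
have drowD v w : drow (v + w) V x = drow v V x + drow w V x.
  by apply/rowP => j; rewrite !mxE dirderivDl.
have drowZ c v : drow (c *: v) V x = c *: drow v V x.
  by apply/rowP => j; rewrite !mxE dirderivZl.
have lcD v w : lie_cov x (v + w) = lie_cov x v + lie_cov x w.
  by rewrite /lie_cov drowD !covecD; ring.
have lcZ c v : lie_cov x (c *: v) = c * lie_cov x v.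
  by rewrite /lie_cov drowZ !covecZ; ring.
have lmDl u v w : lie_met x (u + v) w = lie_met x u w + lie_met x v w.
  by rewrite /lie_met drowD !(bformDl, bformDr); ring.
have lmZl c v w : lie_met x (c *: v) w = c * lie_met x v w.
  by rewrite /lie_met drowZ !(bformZl, bformZr); ring.
have lmC v w : lie_met x v w = lie_met x w v.
  rewrite /lie_met (bform_sym v w (dmat_sym oU sA (V x) Ux)).
  by rewrite (bform_sym (drow v V x) w (sA Ux)) (bform_sym v (drow w V x) (sA Ux)); ring.
have lXX : lie_met x (X x) (X x) = 2 * lie_cov x (X x).
  rewrite /lie_met /lie_cov (bform_sym _ (X x) (sA Ux)) AX//.
  rewrite -dform_partialE (unitX_dir (fun k => unit_derivative k Ux)) dcovec_partialE; ring.
have eq t w : covec (B x) w = 0 -> 0 < t ->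
   t ^+ 2 * (t * lie_cov x (X x) + lie_cov x w)
     + e * ((t ^+ 2 * lie_met x (X x) (X x) + 2 * t * lie_met x (X x) w + lie_met x w w) * t
            - 2 * (t ^+ 2 + bform (A x) w w) * (t * lie_cov x (X x) + lie_cov x w))
   = 2 * k * t ^+ 3.
  move=> bw t0; have tn0 : t != 0 by rewrite gt_eqF.
  set y := t *: X x + w.
  have by0 : covec (B x) y = t by rewrite covecD covecZ BX// bw; ring.
  have yy : bform (A x) y y = t ^+ 2 + bform (A x) w w.
    rewrite /y !(bformDl, bformDr, bformZl, bformZr) (bform_sym w (X x) (sA Ux)) !AX// BX// bw.
    by ring.
  have g0 := gauge_gt0 e (A x) (B x) y.
  have := hc y; rewrite (FE y Ux) /exp_norm by0 complete_liftE ?by0// yy.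
  rewrite mulr_gt0// => /(_ erefl) h.
  have lcy : lie_cov x y = t * lie_cov x (X x) + lie_cov x w by rewrite lcD lcZ.
  have lmy : lie_met x y y = t ^+ 2 * lie_met x (X x) (X x) + 2 * t * lie_met x (X x) w
     + lie_met x w w.
    by rewrite lmDl lmZl !(lmC _ y) !lmDl !lmZl (lmC w (X x)); ring.
  rewrite -lcy -lmy.
  have gn0 : gauge e (A x) (B x) y != 0 by rewrite gt_eqF.
  apply: (mulfI gn0); transitivity (t ^+ 2 * (2 * k * (t * gauge e (A x) (B x) y))).
    by rewrite -h; field.
  by ring.
have coef w bw := conformal_coefficients e2 lXX (fun t => @eq t w bw).
have bX : lie_cov x (X x) = 2 * k.
  by have [] := coef 0 (covec0 _).
have perp w : covec (B x) w = 0 -> [/\ lie_cov x w = 0, lie_met x (X x) w = 0 &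
    lie_met x w w = 4 * k * bform (A x) w w].
  move=> bw; have [_ h1 h2 h3] := coef w bw.
  have lw : lie_cov x w = 0.
    have [->|w0] := eqVneq w 0; first by rewrite -(scale0r 0) lcZ mul0r.
    have W0 := pA Ux w0; apply: (mulfI (lt0r_neq0 W0)); by rewrite mulr0.
  split=> //; last by rewrite h3 bX; ring.
  have e0 : 2 * e != 0 by rewrite mulf_neq0// ?pnatr_eq0// -sqrf_eq0 e2 oner_eq0.
  by apply: (mulfI e0); rewrite mulr0 -h2 lw; ring.
have dec v : exists t w, covec (B x) w = 0 /\ v = t *: X x + w.
  exists (covec (B x) v), (v - covec (B x) v *: X x); split; last by rewrite addrC subrK.
  by rewrite covecD -scaleNr covecZ BX// mulr1 subrr.
have quad v : lie_met x v v = 4 * k * bform (A x) v v.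
  have [t [w [bw ->]]] := dec v; have [_ l2 l3] := perp w bw.
  rewrite !(bformDl, bformDr, bformZl, bformZr) (bform_sym w (X x) (sA Ux)) !AX// BX// bw.
  rewrite lmDl lmZl !(lmC _ (t *: X x + w)) !lmDl !lmZl (lmC w (X x)) l2 l3 lXX bX; ring.
split=> [w|v w].
  have [t [u [bu ->]]] := dec w; have [l1 _ _] := perp u bu.
  by rewrite lcD lcZ l1 bX covecD covecZ BX// bu; ring.
have := quad (v + w); rewrite lmDl !(lmC _ (v + w)) !lmDl !(bformDl, bformDr).
rewrite (lmC w v) (bform_sym w v (sA Ux)) (quad v) (quad w) => h; lra.
Qed.
End UnitChart.

(** * Vanishing of the gradient of the factor *)

Section FactorGradient.
Variables (R : realType) (n : nat).
Local Notation E := 'rV[R]_n.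

Lemma exists_orthogonal (b : E) : (2 <= n)%N -> exists2 w : E, w != 0 & covec b w = 0.
Proof.
move=> hn; pose i0 := Ordinal (ltnW hn : 0 < n)%N; pose i1 := Ordinal (hn : 1 < n)%N.
have i01 : (i1 == i0) = false by [].
have [b0|b0] := eqVneq (b 0 i0) 0.
  exists (delta_mx 0 i0); last by rewrite covec_delta.
  by apply/eqP => /rowP/(_ i0); rewrite !mxE !eqxx => /eqP; rewrite oner_eq0.
exists (b 0 i0 *: delta_mx 0 i1 + (- b 0 i1) *: delta_mx 0 i0).
  apply/eqP => /rowP/(_ i1); rewrite !mxE !eqxx i01 /= mulr1 mulr0 addr0 => /eqP.
  by rewrite (negPf b0).
by rewrite covecD !covecZ !covec_delta; ring.
Qed.

(** Evaluating at a vector orthogonal to [b] gives [d X = 0], hence $d\cdot\beta = 0$. *)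
Lemma gradient_eq0 (a : 'M[R]_n) (b X : E) (d : E -> R) : (2 <= n)%N ->
  (forall y, y != 0 -> 0 < bform a y y) -> covec b X = 1 ->
  (forall u w, d (u + w) = d u + d w) ->
  (forall v, d v * covec b v = d X * bform a v v) -> forall v, d v = 0.
Proof.
move=> hn pa bX dD h v.
have [w w0 bw] := exists_orthogonal b hn.
have dX : d X = 0.
  apply: (mulIf (lt0r_neq0 (pa w w0))); by rewrite -h bw mulr0 mul0r.
have h0 u : d u * covec b u = 0 by rewrite h dX mul0r.
have [bv|bv] := eqVneq (covec b v) 0; last first.
  by apply: (mulIf bv); rewrite h0 mul0r.
by have := h0 (v + X); rewrite dD dX covecD bv bX add0r mulr1 addr0.
Qed.

(** Balls are convex, so the mean value theorem applies on segments issued from [x]. *)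
Lemma locally_constant (U : set E) (f : E -> R) x : open U -> U x -> Ck 1 U f ->
  (forall z v, U z -> dirderiv v f z = 0) -> \forall z \near x, f z = f x.
Proof.
move=> oU Ux Cf d0.
have [r /= r0 rU] := (nbhs_ballP _ _).1 (open_nbhs_nbhs (conj oU Ux)).
apply/nbhs_ballP; exists r => // z xz /=.
have UU t : 0 <= t <= 1 -> U (t *: (z - x) + x).
  move=> /andP[t0 t1]; apply: rU; move: xz; rewrite -!ball_normE /= => xz.
  rewrite opprD addrCA subrr addr0 normrN normrZ (ger0_norm t0).
  by rewrite (le_lt_trans _ xz)// -[X in _ <= X]normrN opprB ler_piMl.
have dd t : 0 <= t <= 1 -> is_derive (t *: (z - x) + x) (z - x) f 0.
  by move=> /UU Ut; have := Ck_is_derive_dir (z - x) oU Cf Ut; rewrite -/(dirderiv _ _ _) d0.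
have [|t tI] := @MVT_line R _ f x (z - x); first by move=> t /dd[].
by rewrite subrK; have [_ ->] := dd t tI => /eqP; rewrite subr_eq0 => /eqP.
Qed.
End FactorGradient.


(** * Normalization of the form to unit length *)

Section Normalization.
Variables (R : realType) (n : nat).
Local Notation E := 'rV[R]_n.
Variables (U : set E) (a : E -> 'M[R]_n) (b : E -> E) (e : R).
Hypothesis oU : open U.
Hypothesis Ca : forall k, Ck_matrix_field k U a.
Hypothesis Cb : forall k, Ck_row_field k U b.
Hypothesis sa : forall x, U x -> (a x)^T = a x.
Hypothesis pa : forall x y, U x -> y != 0 -> 0 < bform (a x) y y.
Hypothesis b0 : forall x, U x -> b x != 0.
Hypothesis e2 : e ^+ 2 = 1.
Implicit Types (x y v : E).

Definition dualv x : E := b x *m invmx (a x).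
Definition sqnorm x : R := covec (b x) (dualv x).
(** The length of $\beta$ for $A + k\beta^2$ is $1$ when
    $k = 1 - |\beta|^{-2}$, because $|\beta|^{-2}$ becomes $|\beta|^{-2} + k$. *)
Definition shiftc x : R := 1 - (sqnorm x)^-1.
Definition scalec x : R := - e * shiftc x.
Definition unit_metric x : 'M[R]_n :=
  expR (2 * scalec x) *: (a x + shiftc x *: ((b x)^T *m b x)).
Definition unit_form x : E := expR (scalec x) *: b x.
Definition unit_dual x : E := (expR (- scalec x) / sqnorm x) *: dualv x.

Lemma metric_unit x : U x -> a x \in unitmx.
Proof.
move=> Ux; rewrite unitmxE unitfE; apply/negP => /det0P[v v0 va].
by have := pa Ux v0; rewrite bformE va covecC covec0 ltxx.
Qed.

Lemma bform_dualv x v : U x -> bform (a x) (dualv x) v = covec (b x) v.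
Proof. by move=> Ux; rewrite bformE /dualv mulmxKV// metric_unit. Qed.

Lemma sqnorm_gt0 x : U x -> 0 < sqnorm x.
Proof.
move=> Ux; rewrite /sqnorm -bform_dualv//; apply: pa => //.
apply/eqP => d0; have := b0 Ux; have := mulmxKV (metric_unit Ux) (b x).
by rewrite -/(dualv x) d0 mul0mx => <-; rewrite eqxx.
Qed.

Lemma bform_outer (c : E) u v : bform (c^T *m c) u v = covec c u * covec c v.
Proof.
rewrite /bform /covec big_distrlr; apply: eq_bigr => k _; apply: eq_bigr => l _ /=.
by rewrite mxE big_ord1 mxE; ring.
Qed.

Lemma unit_metricE x u v : bform (unit_metric x) u v =
  expR (2 * scalec x) * (bform (a x) u v + shiftc x * (covec (b x) u * covec (b x) v)).
Proof. by rewrite bform_matZ bform_matD bform_matZ bform_outer. Qed.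

Lemma unit_formE x v : covec (unit_form x) v = expR (scalec x) * covec (b x) v.
Proof. by rewrite covecC covecZ covecC. Qed.

Lemma unit_metric_sym x : U x -> (unit_metric x)^T = unit_metric x.
Proof.
by move=> Ux; rewrite /unit_metric linearZ linearD linearZ /= sa// trmx_mul trmxK.
Qed.

Lemma expR_double r : expR (2 * r) = expR r ^+ 2 :> R.
Proof. by rewrite mulrDl mul1r expRD. Qed.

(** Splitting off the component along the dual vector, $A + k\beta^2$ is
    $|w|^2 + \beta^2$ with $w$ orthogonal to it. *)
Lemma unit_metric_gt0 x y : U x -> y != 0 -> 0 < bform (unit_metric x) y y.
Proof.
move=> Ux y0; rewrite unit_metricE mulr_gt0 ?expR_gt0//.
have N0 := sqnorm_gt0 Ux; set N := sqnorm x in N0 *.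
have Nn0 : N != 0 by rewrite gt_eqF.
set t := covec (b x) y.
have [w [bw yE]] : exists w, covec (b x) w = 0 /\ y = (t / N) *: dualv x + w.
  exists (y - (t / N) *: dualv x); split; last by rewrite addrC subrK.
  by rewrite -scaleNr covecD covecZ -/t -/(sqnorm x) -/N; field.
have yy : bform (a x) y y = t ^+ 2 / N + bform (a x) w w.
  rewrite [in LHS]yE !(bformDl, bformDr, bformZl, bformZr) (bform_sym w (dualv x) (sa Ux)).
  by rewrite !bform_dualv// bw -/(sqnorm x) -/N; field.
have -> : bform (a x) y y + shiftc x * (t * t) = bform (a x) w w + t ^+ 2.
  by rewrite yy /shiftc -/N; field.
have [w0|w0] := eqVneq w 0; last by rewrite ltr_pwDl ?sqr_ge0// pa.
have tn0 : t != 0.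
  by apply: contraNneq y0 => t0; rewrite yE w0 t0 mul0r scale0r addr0.
by rewrite w0 bform0l add0r exprn_even_gt0.
Qed.

Lemma unit_metric_dual x v : U x -> bform (unit_metric x) (unit_dual x) v = covec (unit_form x) v.
Proof.
move=> Ux; have N0 := sqnorm_gt0 Ux; have Nn0 : sqnorm x != 0 by rewrite gt_eqF.
rewrite unit_metricE unit_formE /unit_dual bformZl covecZ bform_dualv// -/(sqnorm x).
have En : expR (scalec x) != 0 by rewrite gt_eqF// expR_gt0.
rewrite expR_double expRN /shiftc; field.
by rewrite Nn0 En.
Qed.

Lemma unit_form_dual x : U x -> covec (unit_form x) (unit_dual x) = 1.
Proof.
move=> Ux; have N0 := sqnorm_gt0 Ux; have Nn0 : sqnorm x != 0 by rewrite gt_eqF.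
rewrite unit_formE covecZ -/(sqnorm x) expRN.
have En : expR (scalec x) != 0 by rewrite gt_eqF// expR_gt0.
by field; rewrite Nn0 En.
Qed.

(** Adding $k\beta^2$ to $\alpha^2$ multiplies the norm by $e^{\epsilon k}$, and
    scaling $\alpha$ and $\beta$ by $e^{-\epsilon k}$ undoes it. *)
Lemma exp_norm_normalized x y : exp_norm e (a x) (b x) y = exp_norm e (unit_metric x) (unit_form x) y.
Proof.
rewrite /exp_norm /gauge unit_formE unit_metricE.
have [->|y0] := eqVneq (covec (b x) y) 0; first by rewrite !(mul0r, mulr0).
have En : expR (scalec x) != 0 by rewrite gt_eqF// expR_gt0.
set t := covec _ _ in y0 *; set Q := bform _ _ _.
have -> : e * (expR (2 * scalec x) * (Q + shiftc x * (t * t)) / (expR (scalec x) * t) ^+ 2) =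
   e * (Q / t ^+ 2) - scalec x.
  by rewrite expR_double /scalec; field; rewrite En y0.
by rewrite expRD expRN; field.
Qed.

Lemma Ck_dualv k : Ck_row_field k U dualv.
Proof.
move=> j; apply: (Ck_ext (f := fun x => \sum_i b x 0 i * invmx (a x) i j)) => //.
  by move=> x _; rewrite mxE.
apply: Ck_sum => // i; apply: CkM => //; first exact: Cb.
by apply: Ck_invmx => //; [exact: metric_unit|exact: Ca].
Qed.

Lemma Ck_sqnorm k : Ck k U sqnorm.
Proof. by apply: Ck_sum => // j; apply: CkM => //; [exact: Cb|exact: Ck_dualv]. Qed.

Lemma Ck_shiftc k : Ck k U shiftc.
Proof.
apply: CkB => //; first exact: Ck_cst.
apply: CkV => //; last exact: Ck_sqnorm.
by move=> x /sqnorm_gt0 N0; rewrite gt_eqF.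
Qed.

Lemma Ck_scalec k : Ck k U scalec.
Proof. by apply: CkM => //; [exact: Ck_cst|exact: Ck_shiftc]. Qed.

Lemma Ck_unit_metric k : Ck_matrix_field k U unit_metric.
Proof.
move=> i j; apply: (Ck_ext (f := fun x => expR (2 * scalec x) *
   (a x i j + shiftc x * (b x 0 i * b x 0 j)))) => //.
  by move=> x _; rewrite !mxE big_ord1 !mxE.
apply: CkM => //.
  by apply: Ck_expR => //; apply: CkM => //; [exact: Ck_cst|exact: Ck_scalec].
apply: CkD => //; first exact: Ca.
by apply: CkM => //; [exact: Ck_shiftc|apply: CkM => //; exact: Cb].
Qed.

Lemma Ck_unit_form k : Ck_row_field k U unit_form.
Proof.
move=> j; apply: (Ck_ext (f := fun x => expR (scalec x) * b x 0 j)) => //.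
  by move=> x _; rewrite mxE.
by apply: CkM => //; [apply: Ck_expR => //; exact: Ck_scalec|exact: Cb].
Qed.

Lemma Ck_unit_dual k : Ck_row_field k U unit_dual.
Proof.
move=> j; apply: (Ck_ext (f := fun x => expR (- scalec x) * (sqnorm x)^-1 * dualv x 0 j)) => //.
  by move=> x _; rewrite [in RHS]mxE.
apply: CkM => //; last exact: Ck_dualv.
apply: CkM => //.
  by apply: Ck_expR => //; apply: CkN => //; exact: Ck_scalec.
apply: CkV => //; last exact: Ck_sqnorm.
by move=> x /sqnorm_gt0 N0; rewrite gt_eqF.
Qed.
End Normalization.

(** * The theorem on a manifold *)

Section Global.
Variables (R : realType) (n : nat) (M : manifold R n).
Local Notation E := 'rV[R]_n.
Local Notation ch := (@mchart R n M).
Variables (a : riemannian_metric M) (b : one_form M) (s : bool).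
Hypothesis hn : (2 <= n)%N.
Hypothesis hb : nowhere_vanishing b.
Let e : R := (-1) ^+ s.
Local Notation F := (exp_metric a b s).

Lemma sign_sqr : e ^+ 2 = 1. Proof. exact: sqrr_sign. Qed.

Lemma alpha_sqr i x y : ccod (ch i) x -> alpha a i x y ^+ 2 = bform (acoord a i x) y y.
Proof.
move=> Ux; rewrite /alpha sqr_sqrtr//.
have [->|y0] := eqVneq y 0; last exact/ltW/apositive.
by rewrite -/(bform _ _ _) bform0l.
Qed.

Lemma exp_metricE i x y : ccod (ch i) x ->
  F i x y = exp_norm e (acoord a i x) (bcoord b i x) y.
Proof. by move=> Ux; rewrite /exp_metric alpha_sqr. Qed.

Section Chart.
Variable i : mindex M.
Local Notation U := (ccod (ch i)).
Local Notation A := (unit_metric (acoord a i) (bcoord b i) e).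
Local Notation B := (unit_form (acoord a i) (bcoord b i) e).
Local Notation X := (unit_dual (acoord a i) (bcoord b i) e).

Let oU : open U. Proof. exact: ccod_open. Qed.
Let Ca k : Ck_matrix_field k U (acoord a i). Proof. by move=> j l; exact: asmooth. Qed.
Let Cb k : Ck_row_field k U (bcoord b i). Proof. by move=> j; exact: bsmooth. Qed.
Let sa x : U x -> (acoord a i x)^T = acoord a i x. Proof. exact: asymmetric. Qed.
Let pa x y : U x -> y != 0 -> 0 < bform (acoord a i x) y y. Proof. exact: apositive. Qed.
Let b0 x : U x -> bcoord b i x != 0. Proof. exact: hb. Qed.

Let CA : Ck_matrix_field 2 U A.
Proof. exact: Ck_unit_metric. Qed.
Let CB : Ck_row_field 2 U B.
Proof. exact: Ck_unit_form. Qed.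
Let CX : Ck_row_field 2 U X.
Proof. exact: Ck_unit_dual. Qed.
Let sA x : U x -> (A x)^T = A x.
Proof. exact: unit_metric_sym. Qed.
Let pA x y : U x -> y != 0 -> 0 < bform (A x) y y.
Proof. exact: unit_metric_gt0. Qed.
Let AX x v : U x -> bform (A x) (X x) v = covec (B x) v.
Proof. exact: unit_metric_dual. Qed.
Let BX x : U x -> covec (B x) (X x) = 1.
Proof. exact: unit_form_dual. Qed.
Let FE x y : U x -> F i x y = exp_norm e (A x) (B x) y.
Proof. by move=> Ux; rewrite exp_metricE// -exp_norm_normalized. Qed.

Lemma killing_chart x v :
  ((3 <= n)%N /\ landsberg F) \/ douglas F -> U x ->
  bform (dmat (X x) A x) v v + 2 * covec (drow v B x) v - 2 * bform (dmat v A x) (X x) v = 0.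
Proof.
move=> hF Ux; case: hF => [[_ hL]|hD].
  apply: (killing_of_landsberg oU CA CB CX sA pA AX BX sign_sqr FE Ux) => y y0 uy.
  by apply: hL.
apply: (killing_of_douglas oU CA CB CX sA pA AX BX sign_sqr FE Ux) => j k.
by have [q cq qE] := hD i x Ux j k; exists q => // y y0 uy; apply: qE.
Qed.

Variables (V : vector_field M) (c : M -> R).
Hypothesis hF : ((3 <= n)%N /\ landsberg F) \/ douglas F.
Hypothesis hc : conformal_with_factor F V c.

Let CV : Ck_row_field 2 U (vcoord V i). Proof. by move=> j; exact: vsmooth. Qed.

(** The factor $c$ read in the chart, expressed by smooth data: nothing is assumed on
    the regularity of $c$. *)
Let cc x : R := 2^-1 * lie_cov B (vcoord V i) x (X x).

Let Ck_cc : Ck 1 U cc.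
Proof.
have dir (f : E -> R) (W : E -> E) : Ck 2 U f -> Ck_row_field 2 U W ->
    Ck 1 U (fun x => dirderiv (W x) f x).
  move=> Cf CW.
  exact: (Ck_sum _ _ oU (fun j => CkM oU (CkS (CW j)) (Ck_partial j Cf))).
have drowC (W W' : E -> E) j : Ck_row_field 2 U W -> Ck_row_field 2 U W' ->
    Ck 1 U (fun x => drow (W x) W' x 0 j).
  move=> CW CW'; apply: (Ck_ext oU _ (dir _ _ (CW' j) CW)) => x _.
  by rewrite mxE.
have h1 j := CkM oU (drowC _ _ j CV CB) (CkS (CX j)).
have h2 j := CkM oU (CkS (CB j)) (drowC _ _ j CX CV).
exact: (CkM oU (Ck_cst 1 2^-1 oU) (CkD oU (Ck_sum _ _ oU h1) (Ck_sum _ _ oU h2))).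
Qed.

Let lie x : U x ->
  (forall w, lie_cov B (vcoord V i) x w = 2 * c (of_coord (ch i) x) * covec (B x) w) /\
  (forall v w, lie_met A (vcoord V i) x v w
     = 4 * c (of_coord (ch i) x) * bform (A x) v w).
Proof.
move=> Ux; apply: (lie_equations oU CA CB CX sA pA AX BX sign_sqr FE Ux) => y y0.
by apply: hc.
Qed.

Let ccE x : U x -> cc x = c (of_coord (ch i) x).
Proof. by move=> Ux; rewrite /cc (lie Ux).1 BX// mulr1 mulKf// pnatr_eq0. Qed.

Lemma factor_gradient x v : U x -> dirderiv v cc x = 0.
Proof.
move=> Ux; apply: (@gradient_eq0 R n (A x) (B x) (X x) (fun v => dirderiv v cc x)) => //.
- by move=> y; exact: pA.
- exact: BX.
- by move=> u w; exact: dirderivDl.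
move=> w; apply: (conformal_factor_relation oU CA CB CX CV Ck_cc sA pA AX) => //.
- by move=> z u Uz; exact: killing_chart.
- by move=> z u Uz; rewrite ccE//; exact: (lie Uz).1.
- by move=> z u u' Uz; rewrite ccE//; exact: (lie Uz).2.
Qed.

Lemma factor_locally_constant p : cdom (ch i) p -> \forall q \near p, c q = c p.
Proof.
move=> pU; have xU := to_coord_in pU.
have near_x := locally_constant oU xU Ck_cc (fun z v Uz => factor_gradient v Uz).
have cont := to_coord_continuous pU.
near=> q.
have qU : cdom (ch i) q by near: q; apply: open_nbhs_nbhs; split => //; exact: cdom_open.
have : cc (to_coord (ch i) q) = cc (to_coord (ch i) p) by near: q; exact: cont near_x.
by rewrite !ccE ?to_coordK//; exact: to_coord_in.
Unshelve. all: by end_near. Qed.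
End Chart.
End Global.

(* 2 <= n is the usual standing assumption: for n = 1 every F is both Landsberg
   and Douglas, and every vector field is conformal. *)
Theorem theorem5p6 (R : realType) (n : nat) (hn : (2 <= n)%N)
    (M : manifold R n) (a : riemannian_metric M) (b : one_form M)
    (hb : nowhere_vanishing b) (s : bool) :
  ((3 <= n)%N /\ landsberg (exp_metric a b s)) \/ douglas (exp_metric a b s) ->
  forall V : vector_field M,
    conformal (exp_metric a b s) V -> homothetic (exp_metric a b s) V.
Proof.
move=> hF V [c hc].
have lc (p : M) : \forall q \near p, c q = c p.
  by have [i ip] := mcover p; exact: (factor_locally_constant hn hb hF hc ip).
have cst_c (p q : M) : c q = c p.
  have oS (P : R -> Prop) : open [set r : M | P (c r)].
    rewrite openE => r Pr; rewrite /interior; have := lc r.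
    by apply: filterS => z /= ->.
  have : [set r : M | c r = c p] = [set: M].
    apply: (@mconnected R n M) => //.
    - by exists p.
    - by exists [set r | c r = c p]; [exact: (oS (fun t => t = c p))|rewrite setTI].
    - exists [set r | c r = c p]; last by rewrite setTI.
      by rewrite -openC; exact: (oS (fun t => t <> c p)).
  by move=> /seteqP[_ /(_ q I)].
have [[p _]|noM] := pselect (exists p : M, True).
  by exists (c p) => i x y xy; rewrite (hc i x y xy) (cst_c p).
exists 0 => i x y xy; case: noM; by exists (of_coord (mchart i) x).
Qed.
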